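(* For the indices appearing below put $$P_{ijk}=\rho_{jk}\,e^{\frac1\hbar p_i(u_k-u_j)}e^{\frac{\lambda_{jk}}{\hbar}(u_k-u_i)},\qquad P^K_{ijkl}=\rho_{jl}\,e^{\frac1\hbar p_i(u_l-u_j)}e^{\frac{\lambda_{jl}}{2\hbar}(2u_k-2u_i+u_l-u_j)},$$ elements of $N(C_3)\rtimes\mathfrak S_9$, and $$\mathcal R_{ijk}=\mathcal R(\lambda_i,\lambda_j,\lambda_k)_{ijk}=\Psi_q\big(e^{p_i+u_i+p_k-u_k-p_j+\lambda_{ik}}\big)P_{ijk},$$ $$\mathcal K_{ijkl}=\mathcal K(\lambda_i,\lambda_j,\lambda_k,\lambda_l)_{ijkl}=\Psi_{q^2}\big(e^{p_j+u_j+p_l-u_l-2p_k+\lambda_{jl}}\big)\Psi_q\big(e^{p_i+u_i+p_k-u_k-p_j+\lambda_{ik}}\big)\Psi_{q^2}\big(e^{p_j+u_j+p_l-u_l-2p_k+\lambda_{jl}}\big)^{-1}P^K_{ijkl}.$$ (1) The operators $P_{ijk}$ and $P^K_{ijkl}$ satisfy the 3D reflection equation in $N(C_3)\rtimes\mathfrak S_9$: $$P_{457}P^K_{4689}P^K_{2379}P_{258}P_{178}P^K_{1356}P_{124}=P_{124}P^K_{1356}P_{178}P_{258}P^K_{2379}P^K_{4689}P_{457}.$$ (2) The operators $\mathcal R_{ijk}$ and $\mathcal K_{ijkl}$ satisfy the 3D reflection equation in $\hat{\mathcal W}_{\mathbb A}^{\times}\rtimes G$: $$\mathcal R(\lambda_{457})_{457}\mathcal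 K(\lambda_{4689})_{4689}\mathcal K(\lambda_{2379})_{2379}\mathcal R(\lambda_{258})_{258}\mathcal R(\lambda_{178})_{178}\mathcal K(\lambda_{1356})_{1356}\mathcal R(\lambda_{124})_{124}$$ $$=\mathcal R(\lambda_{124})_{124}\mathcal K(\lambda_{1356})_{1356}\mathcal R(\lambda_{178})_{178}\mathcal R(\lambda_{258})_{258}\mathcal K(\lambda_{2379})_{2379}\mathcal K(\lambda_{4689})_{4689}\mathcal R(\lambda_{457})_{457},$$ where $\lambda_{ijk}=(\lambda_i,\lambda_j,\lambda_k)$ and $\lambda_{ijkl}=(\lambda_i,\lambda_j,\lambda_k,\lambda_l)$.
   Context: $q=e^{\hbar}$. $\lambda_1,\dots,\lambda_9$ are complex parameters, $\kappa_i=e^{\lambda_i}$, and a two-index symbol $\lambda_{jk}$ denotes $\lambda_j-\lambda_k$. The noncommuting variables $p_i,u_i$ ($1\le i\le 9$) satisfy $[p_i,u_i]=2\hbar$ for $i=3,6,9$, $[p_i,u_i]=\hbar$ for $i=1,2,4,5,7,8$, $[p_i,u_j]=0$ for $i\ne j$, $[p_i,p_j]=[u_i,u_j]=0$. $\mathcal W(C_3)$ is the $\mathbb C$-algebra generated by the resulting $q$-commuting $e^{\pm p_i},e^{\pm u_i}$, and $\mathrm{Frac}\,\mathcal W(C_3)$ is its noncommuting fractional field. Exponentials of linear combinations of the $p_i,u_i$ and constants are multiplied by the Baker–Campbell–Hausdorff (BCH) formula. $N(C_3)$ is the group generated by $e^{\pm\frac1\hbar p_iu_j}$ ($i\ne j$),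 $e^{\pm\frac a\hbar u_i}$ ($a\in\mathbb C$) and $b\in\mathbb C^\times$ ($i,j\in\{1,\dots,9\}$), with multiplication defined by the (generalized) BCH formula. $\mathfrak S_9$, generated by the transpositions $\rho_{ij}$, acts by permuting the indices of the $p_i,u_i$ (not of the parameters), and $N(C_3)\rtimes\mathfrak S_9$ acts on $\mathcal W(C_3)$ by the adjoint action $\mathrm{Ad}(w)(x)=wxw^{-1}$. Quantum dilogarithm: $\Psi_q(U)=\dfrac1{(-qU;q^2)_\infty}=\sum_{n\ge0}\dfrac{(-qU)^n}{(q^2;q^2)_n}$, with $(z;q)_\infty=\prod_{k\ge0}(1-zq^k)$, $(z;q)_n=(z;q)_\infty/(zq^n;q)_\infty$; $\Psi_{q^2}$ is the same with $q$ replaced by $q^2$. The weighted Fock–Goncharov quiver $J_{123123123}$ has vertices $1,\dots,12$ with weights $d_1=\dots=d_4=2$, $d_5=\dots=d_{12}=1$, ordinary arrows $1\to2\to3\to4$, $5\to6\to7\to8$, $9\to10\to11\to12$, $8\to3\to7\to2\to6\to1$, $12\to7\to11\to6\to10\to5$, and dashed arrows $4\dashrightarrow8\dashrightarrow12$, $1\dashrightarrow5\dashrightarrow9$. Let $\sigma_{ij}$ be the number of arrows from $i$ to $j$ minus the number from $j$ to $i$, a dashed arrow counting $\tfrac12$, and $\hat b_{ij}=\sigma_{ij}d_id_j/\gcd(d_i,d_j)$. $\mathcal Y$ is the skew field generated by $Y_1,\dots,Y_{12}$ with $Y_iY_j=q^{2\hat b_{ij}}Y_jY_i$. $\mathbb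 A$ is the algebra generated over $\mathbb Q(q)$ by the monomials in the $Y_i$ with nonnegative exponents, $\hat{\mathbb A}$ is its completion with respect to the ideal generated by the $Y_i$, and $\hat{\mathbb A}^{\times}\subset\hat{\mathbb A}$ is the subset generated by all invertible elements of $\hat{\mathbb A}$. The embedding $\phi:\mathcal Y\hookrightarrow\mathrm{Frac}\,\mathcal W(C_3)$ is $Y_1\mapsto\kappa_3^{-1}e^{p_3-u_3-2p_2}$, $Y_2\mapsto\kappa_3\kappa_6^{-1}e^{p_3+u_3+p_6-u_6-2p_5}$, $Y_3\mapsto\kappa_6\kappa_9^{-1}e^{p_6+u_6+p_9-u_9-2p_8}$, $Y_4\mapsto\kappa_9e^{p_9+u_9}$, $Y_5\mapsto\kappa_2^{-1}e^{p_2-u_2-p_1}$, $Y_6\mapsto\kappa_2\kappa_5^{-1}e^{p_2+u_2+p_5-u_5-p_3-p_4}$, $Y_7\mapsto\kappa_5\kappa_8^{-1}e^{p_5+u_5+p_8-u_8-p_6-p_7}$, $Y_8\mapsto\kappa_8e^{p_8+u_8-p_9}$, $Y_9\mapsto\kappa_1^{-1}e^{p_1-u_1}$, $Y_{10}\mapsto\kappa_1\kappa_4^{-1}e^{p_1+u_1+p_4-u_4-p_2}$, $Y_{11}\mapsto\kappa_4\kappa_7^{-1}e^{p_4+u_4+p_7-u_7-p_5}$, $Y_{12}\mapsto\kappa_7e^{p_7+u_7-p_8}$. $\mathcal W_{\mathbb A}=\phi(\mathbb A)\subset\mathcal W(C_3)$; $\hat{\mathcal W}_{\mathbb A}$ is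 its completion with respect to the ideal generated by the $\phi(Y_i)$; $\phi$ induces a map $\hat{\mathbb A}\to\hat{\mathcal W}_{\mathbb A}$, and $\hat{\mathcal W}_{\mathbb A}^\times$ is the image of $\hat{\mathbb A}^\times$ under it. Finally $$G=\{w\in N(C_3)\rtimes\mathfrak S_9:\ \mathrm{Ad}(w)(\phi(\mathcal Y))\subset\phi(\mathcal Y)\},$$ which acts on $\hat{\mathcal W}_{\mathbb A}$ and on $\hat{\mathcal W}_{\mathbb A}^\times$ by the adjoint action; this gives the semidirect product $\hat{\mathcal W}_{\mathbb A}^{\times}\rtimes G$.
   Formalization: As Ad(P_124) maps φ(Y_9) outside φ(𝒴), the P's are not in G: the equation is stated with N(C_3)⋊S_9 (weight-preserving permutations) in place of G; after moving the P's to the right, the dilogarithm factors and their product lie in Ŵ_A^×; q=e^ħ is a complex number, not a root of unity. *)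

(* Defs.v *)
From HB Require Import structures.
From mathcomp Require Import all_boot all_order all_algebra perm.
From mathcomp Require Import all_classical all_reals all_analysis.
From mathcomp Require Import complex.

Set Implicit Arguments.
Unset Strict Implicit.
Unset Printing Implicit Defensive.

Import Order.TTheory GRing.Theory Num.Theory.

Local Open Scope classical_set_scope.
Local Open Scope ring_scope.
Local Open Scope complex_scope.

Definition expC (R : realType) (z : R[i]) : R[i] :=
  (expR (complex.Re z))%:C * (cos (complex.Im z) +i* sin (complex.Im z)).

(* Indices 1..9 of the p_i, u_i are the ordinals 0..8: [vtx k] is the index
   written k in the mathematics, for 1 <= k <= 9. *)
Definition vtx (k : nat) : 'I_9 := inZp k.-1.

(* [p_i, u_i] = wt i * hbar *)
Definition wt (i : 'I_9) : int :=
  if i \in [:: vtx 3; vtx 6; vtx 9] then 2 else 1.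

(* (a, b) stands for the linear form sum_i a_i p_i + b_i u_i. *)
Notation lat := ('rV[int]_9 * 'rV[int]_9)%type.

(* (m, c) stands for the linear form m plus the constant c. *)
Notation lform R := (lat * R[i])%type.

(* [m, n] = omega m n * hbar *)
Definition omega (m n : lat) : int :=
  \sum_(i < 9) wt i * (m.1 0 i * n.2 0 i - m.2 0 i * n.1 0 i).

Section LinearForms.
Variable R : realType.

Definition pf (i : 'I_9) : lform R := (delta_mx 0 i, 0, 0).
Definition uf (i : 'I_9) : lform R := (0, delta_mx 0 i, 0).
Definition cst (c : R[i]) : lform R := (0, 0, c).

(* e^L e^M = e^(bch L M) *)
Definition bch (hbar : R[i]) (L M : lform R) : lform R :=
  L + M + cst (hbar / 2 * (omega L.1 M.1)%:~R).

(* Elements of N(C_3), embedded in the group of pairs (b, f) of a scalar b and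
   a bijection f of the linear forms: a product of exponentials times b is sent
   to b and to its adjoint action f, so that w e^L w^-1 = e^(f L).
   Nothing is lost: hbar^-1 p_i u_j (i <> j) and hbar^-1 u_i generate under
   commutators the span of these elements and of the
   hbar^-1 (d_i p_j u_j - d_j p_i u_i), where d = wt; this Lie algebra contains
   no nonzero constant and acts faithfully on the linear forms, so that adding
   the constants is a direct product. *)
Definition Nelt := (R[i] * (lform R -> lform R))%type.

Definition Nmul (x y : Nelt) : Nelt := (x.1 * y.1, x.2 \o y.2).

(* e^X for X = hbar^-1 p_i (sum_j v_j u_j) with v_i = 0: here (ad X)^2 = 0 on
   linear forms, hence Ad(e^X) L = L + [X, L], expanded by the Leibniz rule. *)
Definition exp_pu (i : 'I_9) (v : 'rV[int]_9) : Nelt :=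
  (1, fun L => L + ((0, v, 0) : lform R) *~ omega (delta_mx 0 i, 0) L.1
                 + pf i *~ omega (0, v) L.1).

(* e^X for X = hbar^-1 sum_j a_j u_j *)
Definition exp_u (a : 'rV[R[i]]_9) : Nelt :=
  (1, fun L => L + cst (\sum_(j < 9) a 0 j * (omega (uf j).1 L.1)%:~R)).

Inductive inN : Nelt -> Prop :=
| inN_pu i j : i != j -> inN (exp_pu i (delta_mx 0 j))
| inN_puV i j : i != j -> inN (exp_pu i (- delta_mx 0 j))
| inN_u a i : inN (exp_u (a *: delta_mx 0 i))
| inN_cst b : b != 0 -> inN (b, id)
| inN_mul x y : inN x -> inN y -> inN (Nmul x y).

(* p_i |-> p_(s i), u_i |-> u_(s i) *)
Definition permL (s : 'S_9) (L : lform R) : lform R :=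
  (\row_j L.1.1 0 ((s^-1)%g j), \row_j L.1.2 0 ((s^-1)%g j), L.2).

Definition permN (s : 'S_9) (x : Nelt) : Nelt :=
  (x.1, permL s \o x.2 \o permL (s^-1)%g).

Definition NSelt := (Nelt * 'S_9)%type.

(* [(s * t)%g] applies s first, whence the order in the second component. *)
Definition NSmul (x y : NSelt) : NSelt :=
  (Nmul x.1 (permN x.2 y.1), (y.2 * x.2)%g).

Definition NSone : NSelt := ((1, id), 1%g).

Definition NSprod (s : seq NSelt) : NSelt := foldl NSmul NSone s.

(* A permutation of the indices respects the relations [p_i, u_i] = wt i * hbar,
   and so acts on N(C_3), only if it preserves the weights. *)
Definition inNS (x : NSelt) : Prop :=
  inN x.1 /\ forall i, wt (x.2 i) = wt i.

(* x e^L x^-1 = e^(Ad x L) *)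
Definition Ad (x : NSelt) : lform R -> lform R := x.1.2 \o permL x.2.

Definition rho (j k : 'I_9) : NSelt := ((1, id), tperm j k).
Definition ofN (x : Nelt) : NSelt := (x, 1%g).

Variable lam : 'I_9 -> R[i].

Definition Pop (i j k : 'I_9) : NSelt :=
  NSmul (NSmul (rho j k)
    (ofN (exp_pu i (delta_mx 0 k - delta_mx 0 j))))
    (ofN (exp_u ((lam j - lam k) *: (delta_mx 0 k - delta_mx 0 i)))).

Definition PKop (i j k l : 'I_9) : NSelt :=
  NSmul (NSmul (rho j l)
    (ofN (exp_pu i (delta_mx 0 l - delta_mx 0 j))))
    (ofN (exp_u (((lam j - lam l) / 2) *:
       (2 *: delta_mx 0 k - 2 *: delta_mx 0 i + delta_mx 0 l - delta_mx 0 j)))).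

End LinearForms.

Section FormalSeries.
Variables (R : realType) (hbar : R[i]).

(* f stands for the formal sum of the f m e^m. The sums below are over sets on
   which only finitely many terms are nonzero whenever the supports of the
   series lie in a common finitely generated cone without lines, in particular
   in the cone of the nonnegative combinations of the exponents of the phi(Y_i)
   (which are linearly independent). *)
Definition fseries := lat -> R[i].

Definition Fone : fseries := fun m => (m == 0)%:R.

Definition Fmul (f g : fseries) : fseries := fun m =>
  \sum_(ab \in [set ab : lat * lat | ab.1 + ab.2 = m])
     f ab.1 * g ab.2 * expC (bch hbar (ab.1, 0) (ab.2, 0)).2.

Definition AdF (w : NSelt R) (f : fseries) : fseries := fun m =>
  \sum_(n \in [set n : lat | (Ad w (n, 0)).1 = m])
     f n * expC (Ad w (n, 0)).2.

(* sum_n c_n U^n at U = e^L *)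
Definition subst_exp (c : nat -> R[i]) (L : lform R) : fseries := fun m =>
  \sum_(n \in [set n : nat | (L *+ n).1 = m]) c n * expC (L *+ n).2.

(* (z; t)_n *)
Definition qpoch (z t : R[i]) (n : nat) : R[i] := \prod_(k < n) (1 - z * t ^+ k).

Definition psi_coef (Q : R[i]) (n : nat) : R[i] :=
  (- Q) ^+ n / qpoch (Q ^+ 2) (Q ^+ 2) n.

(* Coefficients 0..n of the inverse of the power series sum_k c_k U^k, where
   c_0 = 1. *)
Fixpoint inv_coefs (c : nat -> R[i]) (n : nat) : seq R[i] :=
  if n is n'.+1 then
    let e := inv_coefs c n' in
    rcons e (- \sum_(k < n'.+1) c (n'.+1 - k)%N * e`_k)
  else [:: 1].

Definition Psi (Q : R[i]) (L : lform R) : fseries := subst_exp (psi_coef Q) L.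

Definition PsiV (Q : R[i]) (L : lform R) : fseries :=
  subst_exp (fun n => (inv_coefs (psi_coef Q) n)`_n) L.

(* The law (f, w) (g, v) = (f w(g), w v) of the semidirect product, read on all
   formal series and with w in N(C_3) x| S_9 instead of G: the operators P_ijk
   do not map phi(Y) into itself, so the single factors of the 3D reflection
   equation make sense only in this larger setting. *)
Definition sdelt := (fseries * NSelt R)%type.

Definition sdmul (x y : sdelt) : sdelt :=
  (Fmul x.1 (AdF x.2 y.1), NSmul x.2 y.2).

Definition sdone : sdelt := (Fone, NSone R).

Definition sdprod (s : seq sdelt) : sdelt := foldl sdmul sdone s.

Variable lam : 'I_9 -> R[i].

Let q : R[i] := expC hbar.

Definition Rop (i j k : 'I_9) : sdelt :=
  (Psi q (pf R i + uf R i + pf R k - uf R k - pf R j + cst (lam i - lam k)),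
   Pop lam i j k).

Definition Kop (i j k l : 'I_9) : sdelt :=
  let A := pf R j + uf R j + pf R l - uf R l - pf R k *+ 2 + cst (lam j - lam l) in
  let B := pf R i + uf R i + pf R k - uf R k - pf R j + cst (lam i - lam k) in
  (Fmul (Fmul (Psi (q ^+ 2) A) (Psi q B)) (PsiV (q ^+ 2) A), PKop lam i j k l).

End FormalSeries.

(* Vertices 1..12 of the quiver are the ordinals 0..11. *)
Definition qwt (i : 'I_12) : nat := if (i < 4)%N then 2 else 1.

Definition solid_arrows : seq (nat * nat) :=
  [:: (1, 2); (2, 3); (3, 4); (5, 6); (6, 7); (7, 8);
      (9, 10); (10, 11); (11, 12);
      (8, 3); (3, 7); (7, 2); (2, 6); (6, 1);
      (12, 7); (7, 11); (11, 6); (6, 10); (10, 5)]%N.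

Definition dashed_arrows : seq (nat * nat) :=
  [:: (4, 8); (8, 12); (1, 5); (5, 9)]%N.

(* 2 sigma_ij *)
Definition sigma2 (i j : 'I_12) : int :=
  let net (s : seq (nat * nat)) : int :=
    (count_mem (i.+1, j.+1) s)%:Z - (count_mem (j.+1, i.+1) s)%:Z in
  2 * net solid_arrows + net dashed_arrows.

(* 2 bhat_ij *)
Definition bhat2 (i j : 'I_12) : int :=
  sigma2 i j * (qwt i * qwt j %/ gcdn (qwt i) (qwt j))%N%:Z.

Section Completion.
Variables (R : realType) (hbar : R[i]) (lam : 'I_9 -> R[i]).

Let q : R[i] := expC hbar.

(* The subfield Q(q) of C *)
Definition inQq (x : R[i]) : Prop :=
  exists f g : {poly rat}, (map_poly ratr g).[q] != 0 /\
    x = (map_poly ratr f).[q] / (map_poly ratr g).[q].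

Notation expo := {ffun 'I_12 -> nat}.

(* a stands for the sum of the a n Y_1^(n_1) ... Y_12^(n_12), in this order. *)
Definition Aseries := expo -> R[i].

Definition inA (a : Aseries) : Prop := forall n, inQq (a n).

Definition Aone : Aseries := fun n => [forall i, n i == 0%N]%:R.

(* Y_i Y_j = q^(bhat2 i j) Y_j Y_i *)
Definition Amul (a b : Aseries) : Aseries := fun n =>
  \sum_(kl \in [set kl : expo * expo | forall i, (kl.1 i + kl.2 i)%N = n i])
     a kl.1 * b kl.2 *
     q ^ (\sum_(i < 12) \sum_(j < 12 | (j < i)%N)
            bhat2 i j * (kl.1 i)%:Z * (kl.2 j)%:Z).

Definition Aunit (a : Aseries) : Prop :=
  inA a /\ exists b, [/\ inA b, Amul a b = Aone & Amul b a = Aone].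

Let p (k : nat) := pf R (vtx k).
Let u (k : nat) := uf R (vtx k).
Let l (k : nat) := cst (lam (vtx k)).

(* phi(Y_i) = e^(phiY i), with kappa_i = e^(lam i) absorbed in the exponent. *)
Definition phiY (i : 'I_12) : lform R :=
  nth 0 [:: - l 3 + p 3 - u 3 - p 2 *+ 2;
            l 3 - l 6 + p 3 + u 3 + p 6 - u 6 - p 5 *+ 2;
            l 6 - l 9 + p 6 + u 6 + p 9 - u 9 - p 8 *+ 2;
            l 9 + p 9 + u 9;
            - l 2 + p 2 - u 2 - p 1;
            l 2 - l 5 + p 2 + u 2 + p 5 - u 5 - p 3 - p 4;
            l 5 - l 8 + p 5 + u 5 + p 8 - u 8 - p 6 - p 7;
            l 8 + p 8 + u 8 - p 9;
            - l 1 + p 1 - u 1;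
            l 1 - l 4 + p 1 + u 1 + p 4 - u 4 - p 2;
            l 4 - l 7 + p 4 + u 4 + p 7 - u 7 - p 5;
            l 7 + p 7 + u 7 - p 8] i.

(* phi(Y_1)^(n_1) ... phi(Y_12)^(n_12) = e^(phi_mon n) *)
Definition phi_mon (n : expo) : lform R :=
  \big[bch hbar/0]_(i < 12) (phiY i *+ n i).

Definition phi_hat (a : Aseries) : fseries R := fun m =>
  \sum_(n \in [set n : expo | (phi_mon n).1 = m]) a n * expC (phi_mon n).2.

(* The image under phi of the units of the completion of A *)
Definition inWAx (f : fseries R) : Prop := exists2 a, Aunit a & f = phi_hat a.

(* Moving the second components to the right in a product of the (f_k, w_k)
   turns f_k into w_1 ... w_(k-1) (f_k); all these series are to be units of
   the completion of phi(A), where the product of the series is then taken. *)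
Definition product_in_WAx (s : seq (sdelt R)) : Prop :=
  (forall k, (k < size s)%N ->
     inWAx (AdF (NSprod (unzip2 (take k s))) (nth (sdone R) s k).1)) /\
  inWAx (sdprod hbar s).1.

End Completion.

(* Main.v *)
Require Import Defs.
From mathcomp Require Import all_boot all_order all_algebra fingroup perm.
From mathcomp Require Import all_classical all_reals all_analysis.
From mathcomp Require Import complex.
From mathcomp Require Import ring zify.

Set Implicit Arguments.
Unset Strict Implicit.
Unset Printing Implicit Defensive.

Import Order.TTheory GRing.Theory Num.Theory.

Local Open Scope ring_scope.
Local Open Scope complex_scope.

(** Write a, b for the long variables Y_2, Y_3 and c, d, e, f for the short ones
    Y_6, Y_7, Y_10, Y_11. Moving every operator P to the right of the
    dilogarithms turns both sides into products of series in these six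
    variables. Conjugation by Psi_(q^2) of a or b turns Psi_q of c, d, ... into
    Psi_q of C = c + q^2 c a, D = d + q^2 d b, and so on; put G = q^-1 a c d.
    The pentagon relation reduces the equality of the two products to

      psi(f) psi(q^-1 D f) psi(C) psi(G) psi(D)
        = psi(C) psi(G) psi(D) psi(q^-1 f C) psi(f),

    which says that M = psi(D)^-1 psi(C) psi(G) psi(D) psi(C)^-1 commutes with
    psi(f). Indeed M commutes with f: by the q-difference equation of psi this
    is a statement on psi(C) psi(G) psi(D) (1 + q C), and it follows from the
    commutation of D with psi(C) and of C with psi(D), which become those of
    monomials after conjugation by Psi_(q^2)(a), respectively Psi_(q^2)(b).

    Identities between series are checked on the action on monomials with
    bounded exponents: there a series without constant term is a nilpotent
    matrix and Psi is a polynomial in it. *)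

(** * Truncated quantum dilogarithms *)

(** C and D do not q-commute: each is a sum of two monomials, and the two summands of one behave
    differently against the other. So no pentagon relates psi(C) and psi(D), and G enters the
    relation between them. What remains is that f q-commutes with C and with D and commutes with G.
    The two pentagons this allows write psi(f) psi(q^-1 D f) as psi(D) psi(f) psi(D)^-1 and psi(C)
    psi(q^-1 f C) as psi(f) psi(C) psi(f)^-1; this is the origin of M.

    Part (1) is a computation. An operator is determined by its scalar, its permutation and its
    adjoint action, and the action by the images of the p_i and u_i, whose coordinates on the p_i,
    u_i and lambda_i / 2 are integers. The same computation gives the exponents of the dilogarithms
    once the operators have been moved away.

    Monomials are taken in Weyl order, as exponentials of linear forms, while series in the Y_i are
    normally ordered. The two differ by powers of q^(1/2); the coefficients lie in Q(q) because for
    every exponent that occurs this power is an integral power of q.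

    Passing to matrices also supplies associativity and inverses, which are hard to see on sums over
    infinite sets. *)

Definition conv (K : pzRingType) (c c' : nat -> K) (n : nat) : K :=
  \sum_(i < n.+1) c i * c' (n - i)%N.

Definition one_coef (K : pzRingType) (n : nat) : K := (n == 0)%:R.

(** The ratio of consecutive coefficients (-Q)^n / (Q^2; Q^2)_n of Psi_Q, cleared of
    denominators. *)
Definition psi_rec (K : pzRingType) (Q : K) (c : nat -> K) :=
  c 0%N = 1 /\ forall n, c n.+1 * (1 - (Q ^+ 2) ^+ n.+1) = - Q * c n.

(* I n plays the role of the n-th power of an ideal whose N-th power is zero. *)
Definition nil_filtration (K : fieldType) (A : algType K) (N : nat)
    (I : nat -> A -> Prop) :=
  [/\ forall n x y, I n x -> I n y -> I n (x + y),
      forall n k x, I n x -> I n (k *: x),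
      forall k m n x y, (k <= m + n)%N -> I m x -> I n y -> I k (x * y),
      I 0 1 &
      forall n x, (N <= n)%N -> I n x -> x = 0].

Section Truncated.
Variables (K : fieldType) (A : algType K) (N : nat).

Definition ev (c : nat -> K) (x : A) : A := \sum_(k < N) c k *: x ^+ k.

(** Every conjugation below is an instance: an element passes a series by transforming the argument
    of the series. *)
Lemma ev_intertwine c x x' y : y * x = x' * y -> y * ev c x = ev c x' * y.
Proof.
move=> h; rewrite mulr_sumr mulr_suml; apply: eq_bigr => k _.
rewrite -scalerAr -scalerAl; congr (_ *: _).
elim: (k : nat) => [|n IH]; first by rewrite !expr0 mulr1 mul1r.
by rewrite exprSr mulrA IH -mulrA h mulrA -exprSr.
Qed.

Lemma ev_one x : (0 < N)%N -> ev (@one_coef K) x = 1.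
Proof.
move=> N0; rewrite /ev; case: N N0 => // n _.
rewrite big_ord_recl /= expr0 scale1r big1 ?addr0 // => i _.
by rewrite /one_coef /= scale0r.
Qed.

(** Regroups a product of two truncated sums by total degree; the part of the square beyond the
    triangle vanishes by nilpotency. *)
Lemma triangle_sum (F : nat -> nat -> A) :
  (forall i j, (N <= i + j)%N -> F i j = 0) ->
  \sum_(i < N) \sum_(j < N) F i j = \sum_(n < N) \sum_(i < n.+1) F i (n - i)%N.
Proof.
move=> F0.
rewrite (eq_bigr (fun i : 'I_N => \sum_(n < N | (i <= n)%N) F i (n - i)%N)).
  rewrite (exchange_big_dep xpredT) //=; apply: eq_bigr => n _.
  rewrite -(big_mkord (fun i => (i <= n)%N) (fun i => F i (n - i)%N)).
  rewrite -(big_mkord xpredT (fun i => F i (n - i)%N)).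
  by rewrite (big_nat_widen 0 n.+1 N) //; apply: ltn_ord.
move=> i _.
rewrite -(big_mkord xpredT (fun j => F i j)).
rewrite -(big_mkord (fun j => (i <= j)%N) (fun n => F i (n - i)%N)).
rewrite (big_cat_nat (n := (N - i)%N)) //= ?leq_subr // [X in _ + X]big1_seq ?addr0.
  rewrite [RHS](big_cat_nat (n := i)) //=; last exact: ltnW.
  rewrite [X in _ = X + _]big1_seq ?add0r; last first.
    by move=> j /andP[h]; rewrite mem_index_iota /= => /leq_trans /(_ h); rewrite ltnn.
  have -> : index_iota i N = index_iota (0 + i) N by [].
  rewrite big_addn; apply: congr_big_nat => // j _.
    by rewrite leq_addl.
  by rewrite addnK.
move=> j; rewrite mem_index_iota => /andP[_ /andP[h _]]; apply: F0.
by rewrite -leq_subLR.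
Qed.

Lemma ev_mul c c' x : x ^+ N = 0 -> ev c x * ev c' x = ev (conv c c') x.
Proof.
move=> xN; rewrite /ev mulr_suml.
transitivity (\sum_(i < N) \sum_(j < N) (c i * c' j) *: x ^+ (i + j)).
  apply: eq_bigr => i _; rewrite mulr_sumr; apply: eq_bigr => j _.
  by rewrite -scalerAr -scalerAl scalerA exprD mulrC.
rewrite (triangle_sum (F := fun i j => (c i * c' j) *: x ^+ (i + j))); last first.
  by move=> i j /subnK <-; rewrite exprD xN mulr0 scaler0.
apply: eq_bigr => n _; rewrite scaler_suml; apply: eq_bigr => i _.
by rewrite subnKC // -ltnS.
Qed.

Section Dilogarithm.
Variables (Q : K) (c : nat -> K).
Hypothesis c_rec : psi_rec Q c.

(** The q-difference equation of Psi. It is exact in spite of the truncation, since the only surplus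
    term is a multiple of x^N. *)
Lemma psi_scale x : x ^+ N = 0 -> ev c (Q ^+ 2 *: x) = (1 + Q *: x) * ev c x.
Proof.
move=> xN; case: c_rec => c0 cS.
rewrite mulrDl mul1r addrC; apply/eqP; rewrite -subr_eq /ev -sumrB; apply/eqP.
rewrite mulr_sumr; case: N xN => [|n] xN; first by rewrite !big_ord0.
rewrite big_ord_recl big_ord_recr /= !expr0 subrr add0r.
rewrite -scalerAl -scalerAr -exprS xN !scaler0 addr0.
apply: eq_bigr => i _; rewrite -scalerAl -scalerAr -exprS exprZn !scalerA.
rewrite -scalerBl /bump /= add1n; congr (_ *: _).
by rewrite -[RHS]opprK -mulNr -cS; ring.
Qed.

Hypothesis Q_generic : forall n, 1 - (Q ^+ 2) ^+ n.+1 != 0.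

(** The q-binomial theorem, with the q-factorials hidden in the coefficients [c]. *)
Lemma psi_binomial (v w : A) n : w * v = Q ^+ 2 *: (v * w) ->
  c n *: (v + w) ^+ n = \sum_(i < n.+1) (c i * c (n - i)%N) *: (v ^+ i * w ^+ (n - i)).
Proof.
move=> h; case: c_rec => c0 cS.
have wv k : w ^+ k * v = (Q ^+ 2) ^+ k *: (v * w ^+ k).
  elim: k => [|k IH]; first by rewrite !expr0 mulr1 mul1r scale1r.
  rewrite [w ^+ _]exprS -mulrA IH -scalerAr [w * (_ * _)]mulrA h -scalerAl scalerA.
  by rewrite -mulrA -exprS -exprSr.
elim: n => [|n IH].
  by rewrite big_ord1 /= !expr0 c0 !mulr1.
apply: (scalerI (Q_generic n)).
rewrite scalerA mulrC cS -scalerA exprSr scalerAl {}IH scaler_sumr.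
pose t (i j : nat) := v ^+ i * w ^+ j.
transitivity
  (- Q *: (\sum_(i < n.+1) (c i * c (n - i)%N * (Q ^+ 2) ^+ (n - i)) *: t i.+1 (n - i)%N
   + \sum_(i < n.+1) (c i * c (n - i)%N) *: t i (n - i).+1)).
  congr (_ *: _); rewrite mulrDr !mulr_suml; congr (_ + _); apply: eq_bigr => i _.
    by rewrite -scalerAl -[_ * _ * v]mulrA wv -scalerAr scalerA [v ^+ _ * _]mulrA -exprSr.
  by rewrite -scalerAl -[_ * _ * w]mulrA -exprSr.
rewrite scalerDr !scaler_sumr.
(* The factor 1 - Q^(2(n+1)) splits as (1 - Q^(2i)) Q^(2(n+1-i)) plus 1 - Q^(2(n+1-i)), the
   contributions of multiplication by v and by w. *)
transitivity
 (\sum_(i < n.+2) (c i * c (n.+1 - i)%N * ((1 - (Q ^+ 2) ^+ i) * (Q ^+ 2) ^+ (n.+1 - i)))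
     *: t i (n.+1 - i)%N +
  \sum_(i < n.+2) (c i * c (n.+1 - i)%N * (1 - (Q ^+ 2) ^+ (n.+1 - i)))
     *: t i (n.+1 - i)%N).
  congr (_ + _).
    rewrite [RHS]big_ord_recl /= expr0 subrr mul0r mulr0 scale0r add0r.
    apply: eq_bigr => i _; rewrite /bump /= add1n subSS scalerA; congr (_ *: _).
    transitivity ((- Q * c i) * c (n - i)%N * (Q ^+ 2) ^+ (n - i)); first by ring.
    by rewrite -cS; ring.
  rewrite [RHS]big_ord_recr /= subnn expr0 subrr mulr0 scale0r addr0.
  apply: eq_bigr => i _; rewrite subSn ?scalerA; last by rewrite -ltnS.
  congr (_ *: _); transitivity (c i * (- Q * c (n - i)%N)); first by ring.
  by rewrite -cS; ring.
rewrite -big_split; apply: eq_bigr => i _ /=; rewrite -scalerDl scalerA; congr (_ *: _).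
have -> : (Q ^+ 2) ^+ n.+1 = (Q ^+ 2) ^+ i * (Q ^+ 2) ^+ (n.+1 - i).
  by rewrite -exprD subnKC // -ltnS.
ring.
Qed.

(** The exponential property of Psi for q-commuting arguments. *)
Lemma psi_add (v w : A) : w * v = Q ^+ 2 *: (v * w) ->
  (forall i j, (N <= i + j)%N -> v ^+ i * w ^+ j = 0) ->
  ev c (v + w) = ev c v * ev c w.
Proof.
move=> h nil; rewrite /ev mulr_suml.
transitivity (\sum_(i < N) \sum_(j < N) (c i * c j) *: (v ^+ i * w ^+ j)).
  rewrite (triangle_sum (F := fun i j => (c i * c j) *: (v ^+ i * w ^+ j))).
    by apply: eq_bigr => n _; apply: psi_binomial.
  by move=> i j /nil ->; rewrite scaler0.
apply: eq_bigr => i _; rewrite mulr_sumr; apply: eq_bigr => j _.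
by rewrite -scalerAr -scalerAl scalerA mulrC.
Qed.

(** By the q-difference equation, conjugation by psi(x) sends y to y (1 + Q x) = y + Q^-1 x y; psi
    of this sum factors by [psi_add]. *)
Lemma psi_pentagon (x y : A) : x * y = Q ^+ 2 *: (y * x) -> Q != 0 ->
  x ^+ N = 0 -> (forall i j, (N <= i + j)%N -> y ^+ i * (Q^-1 *: (x * y)) ^+ j = 0) ->
  ev c x * ev c y = ev c y * ev c (Q^-1 *: (x * y)) * ev c x.
Proof.
move=> h Q0 xN nil; have comm : Q^-1 *: (x * y) * y = Q ^+ 2 *: (y * (Q^-1 *: (x * y))).
  rewrite -scalerAl -scalerAr !scalerA mulrA h -scalerAl scalerA.
  by congr (_ *: _); ring.
rewrite -(psi_add comm nil).
apply: ev_intertwine; rewrite mulrDl.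
transitivity (y * ev c (Q ^+ 2 *: x)).
  by apply/esym/ev_intertwine; rewrite -scalerAr h.
rewrite psi_scale // mulrA mulrDr mulr1 mulrDl; congr (_ + _ * _).
by rewrite -scalerAr h scalerA; congr (_ *: _); field.
Qed.

End Dilogarithm.
End Truncated.

(** * The dilogarithm identity in an algebra with a nilpotent filtration *)

(** A pure word calculation: a letter stands for psi of the element so named, two or three letters
    for psi of a normalized product. After multiplication by D on the right both sides equal E CE GE
    C G D FC F. On the left, D absorbs DEF, [h] and the pentagon of E and F apply, and E is carried
    to the front; on the right, [h] applies at once. *)
Lemma braid_of_pentagons (U : pzRingType) (C G E F D D' CE GE DF EF DEF FC : U) :
  D * D' = 1 ->
  C * E = E * CE * C -> G * E = E * GE * G -> C * GE = GE * C ->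
  D * EF = EF * DEF * D -> E * F = F * EF * E ->
  D * E = E * D -> FC * E = E * FC ->
  F * DF * C * G * D = C * G * D * FC * F ->
  F * DF * C * G * EF * DEF * E = E * CE * GE * F * DF * C * G.
Proof.
move=> DD' hCE hGE hC hDEF hEF hDE hFC h.
have cancelD x y : x * D = y * D -> x = y.
  by move=> e; rewrite -[x]mulr1 -[y]mulr1 -DD' !mulrA e.
apply: cancelD.
transitivity (F * DF * C * G * D * EF * E).
  by rewrite -!mulrA -hDE [DEF * _]mulrA [EF * _]mulrA [EF * _]mulrA -hDEF ?mulrA.
transitivity (C * G * D * (FC * E) * F).
  by rewrite h -!mulrA hEF ?mulrA.
transitivity (C * (G * E) * D * FC * F).
  by rewrite hFC !mulrA -(mulrA (C * G)) hDE ?mulrA.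
transitivity (E * CE * (C * GE) * G * D * FC * F).
  by rewrite hGE !mulrA hCE.
by move: h; rewrite hC -!mulrA => ->.
Qed.

Section Reflection.
Variables (K : fieldType) (A : unitAlgType K) (N : nat) (I : nat -> A -> Prop).
Hypothesis filtI : nil_filtration N I.

Lemma nil_pow n (x : A) : I 1 x -> I n (x ^+ n).
Proof.
case: filtI => _ _ Im I1 _ Ix; elim: n => [|n IH]; first by rewrite expr0.
by rewrite exprS -add1n; apply: (Im _ 1 n).
Qed.

Lemma nil_expr (x : A) : I 1 x -> x ^+ N = 0.
Proof. by case: filtI => _ _ _ _ I0 /(nil_pow N) /I0; apply. Qed.

Lemma nil_expr2 (x y : A) : I 1 x -> I 1 y ->
  forall i j, (N <= i + j)%N -> x ^+ i * y ^+ j = 0.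
Proof.
case: (filtI) => _ _ Im _ I0 Ix Iy i j h.
by apply: (I0 (i + j)%N) => //; apply: (Im _ i j) => //; apply: nil_pow.
Qed.

Variables (q : K) (c1 c2 : nat -> K).
Hypothesis q0 : q != 0.
Hypothesis c1_rec : psi_rec q c1.
Hypothesis c2_rec : psi_rec (q ^+ 2) c2.
Hypothesis q_generic : forall n, 1 - (q ^+ 2) ^+ n.+1 != 0.
Let psi := @ev K A N c1.
Let psi2 := @ev K A N c2.
Hypothesis psi_unit : forall x, I 1 x -> psi x \is a GRing.unit.
Hypothesis psi2_unit : forall x, I 1 x -> psi2 x \is a GRing.unit.

Lemma nilD (x y : A) : I 1 x -> I 1 y -> I 1 (x + y).
Proof. by case: filtI => h _ _ _ _; apply: h. Qed.

Lemma nilZ k (x : A) : I 1 x -> I 1 (k *: x).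
Proof. by case: filtI => _ h _ _ _; apply: h. Qed.

Lemma psi_comm x y : y * x = x * y -> psi x * y = y * psi x.
Proof. by move=> h; apply/esym/ev_intertwine. Qed.

Lemma psi_qcomm x y : I 1 x -> x * y = q ^+ 2 *: (y * x) ->
  psi x * y = y * (1 + q *: x) * psi x.
Proof.
move=> Ix h; rewrite -mulrA -(psi_scale c1_rec (nil_expr Ix)).
by apply/esym/ev_intertwine; rewrite -scalerAr h.
Qed.

(** As q^4 = (q^2)^2 is one step of the difference equation of Psi_(q^2), a single factor 1 + q^2 x
    appears; this is how C and D get their second terms. *)
Lemma psi2_qcomm x y : I 1 x -> x * y = q ^+ 4 *: (y * x) ->
  psi2 x * y = (y + q ^+ 2 *: (y * x)) * psi2 x.
Proof.
move=> Ix h; rewrite scalerAr -[X in X + _]mulr1 -mulrDr.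
rewrite -mulrA -(psi_scale c2_rec (nil_expr Ix)).
by apply/esym/ev_intertwine; rewrite -scalerAr h -exprM.
Qed.

Lemma psi2_qcomm' x y : I 1 x -> y * x = q ^+ 4 *: (x * y) ->
  y * psi2 x = psi2 x * (y + q ^+ 2 *: (x * y)).
Proof.
move=> Ix h; transitivity (psi2 ((q ^+ 2) ^+ 2 *: x) * y).
  by apply: ev_intertwine; rewrite -scalerAl h -exprM.
rewrite /psi2 (psi_scale c2_rec (nil_expr Ix)) -/psi2.
have -> : (1 + q ^+ 2 *: x) * psi2 x = psi2 x * (1 + q ^+ 2 *: x).
  by apply: ev_intertwine; rewrite mulrDl mulrDr mul1r mulr1 -scalerAl -scalerAr.
by rewrite -mulrA mulrDl mul1r -scalerAl.
Qed.

Lemma psi_pent x y : I 1 x -> I 1 y -> I 1 (x * y) -> x * y = q ^+ 2 *: (y * x) ->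
  psi x * psi y = psi y * psi (q^-1 *: (x * y)) * psi x.
Proof.
move=> Ix Iy Ixy h; apply: psi_pentagon => //.
  exact: nil_expr.
by apply: nil_expr2 => //; apply: nilZ.
Qed.

Ltac expand := rewrite ?(mulrDl, mulrDr, mulr1, mul1r, scalerDr, mulrA, =^~ scalerAl,
  =^~ scalerAr, scalerA).

(** The summands d and z shift the argument of psi in opposite directions: for d the factor q^2
    cancels, for z it becomes q^4. The latter costs (1 + q^3 x)(1 + q x), whose products with z are
    written through g = q x z. *)
Lemma psi_split_right x d z g : I 1 x -> x * d = q ^+ 2 *: (d * x) ->
  z * x = q ^+ 2 *: (x * z) -> x * z = q^-1 *: g ->
  (d + z) * psi (q ^+ 2 *: x) =
  psi x * (d + z + (1 + q ^+ 2) *: g + q ^+ 3 *: (x * g)).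
Proof.
move=> Ix hd hz hg.
have e1 : d * psi (q ^+ 2 *: x) = psi x * d.
  by apply: ev_intertwine; rewrite -scalerAr hd.
have e2 : z * psi (q ^+ 2 *: x) = psi (q ^+ 2 *: (q ^+ 2 *: x)) * z.
  by apply: ev_intertwine; rewrite -!(scalerAr, scalerAl) hz.
have I2 := nilZ (q ^+ 2) Ix.
rewrite mulrDl e1 e2 /psi (psi_scale c1_rec (nil_expr I2)).
rewrite (psi_scale c1_rec (nil_expr Ix)) -/psi.
have com : (1 + q *: x) * psi x = psi x * (1 + q *: x).
  by apply: ev_intertwine; rewrite mulrDl mulrDr mul1r mulr1 -scalerAl -scalerAr.
have com' : (1 + q *: (q ^+ 2 *: x)) * psi x = psi x * (1 + q *: (q ^+ 2 *: x)).
  by apply: ev_intertwine; rewrite mulrDl mulrDr mul1r mulr1 scalerA -scalerAl -scalerAr.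
rewrite com mulrA com' -!mulrA -mulrDr -!addrA; congr (_ * (_ + _)).
have -> : g = q *: (x * z) by rewrite hg scalerA divff // scale1r.
expand; rewrite -!addrA; congr (_ + _); rewrite addrA -scalerDl.
congr (_ *: _ + _ *: _); ring.
Qed.

(** Mirror image of [psi_split_right]: x turns psi(d) into psi(q^-2 d) directly, while z leaves the
    two extra factors 1 + q d and 1 + q^-1 d. *)
Lemma psi_split_left x d z g : I 1 d -> d * x = q ^- 2 *: (x * d) ->
  d * z = q ^+ 2 *: (z * d) -> g = q *: (z * d) ->
  psi d * (x + z) =
  (x + z + (1 + q ^- 2) *: g + q^-1 *: (g * d)) * psi (q ^- 2 *: d).
Proof.
move=> Id hx hz hg.
have q2 : q ^+ 2 != 0 by rewrite expf_neq0.
have I2 := nilZ (q ^- 2) Id.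
have dE : psi d = (1 + q^-1 *: d) * psi (q ^- 2 *: d).
  have -> : q^-1 *: d = q *: (q ^- 2 *: d).
    by rewrite scalerA; congr (_ *: _); field.
  rewrite /psi -(psi_scale c1_rec (nil_expr I2)).
  by congr ev; rewrite scalerA divff // scale1r.
rewrite mulrDr.
have -> : psi d * x = x * psi (q ^- 2 *: d).
  by apply/esym/ev_intertwine; rewrite hx -scalerAr.
rewrite psi_qcomm // dE !mulrA -mulrDl; congr (_ * _).
rewrite hg; expand; rewrite -!addrA; congr (_ + (_ + _)).
rewrite addrA -scalerDl; congr (_ *: _ + _ *: _); by field.
Qed.

Variables a b c d e f : A.
Hypotheses (Ia : I 1 a) (Ib : I 1 b) (Ic : I 1 c) (Id : I 1 d) (Ie : I 1 e) (If : I 1 f).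
Hypothesis hba : b * a = q ^- 4 *: (a * b).
Hypothesis hca : c * a = q ^- 4 *: (a * c).
Hypothesis hda : d * a = q ^+ 4 *: (a * d).
Hypothesis hea : e * a = (a * e).
Hypothesis hfa : f * a = (a * f).
Hypothesis hcb : c * b = (b * c).
Hypothesis hdb : d * b = q ^- 4 *: (b * d).
Hypothesis heb : e * b = (b * e).
Hypothesis hfb : f * b = (b * f).
Hypothesis hdc : d * c = q ^- 2 *: (c * d).
Hypothesis hec : e * c = q ^- 2 *: (c * e).
Hypothesis hfc : f * c = q ^+ 2 *: (c * f).
Hypothesis hed : e * d = (d * e).
Hypothesis hfd : f * d = q ^- 2 *: (d * f).
Hypothesis hfe : f * e = q ^- 2 *: (e * f).

Let swap3 (s : K) (x y : A) (h : y * x = s *: (x * y)) z : z * y * x = s *: (z * x * y).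
Proof. by rewrite -mulrA h -scalerAr mulrA. Qed.

Let comm3 (x y : A) (h : y * x = x * y) z : z * y * x = z * x * y.
Proof. by rewrite -mulrA h mulrA. Qed.

(** Rules bringing monomials into alphabetical order; the variants with a left factor act inside
    products associated to the left. *)
Let ordered := (hba, hca, hda, hea, hfa, hcb, hdb, heb, hfb, hdc, hec, hfc, hed, hfd, hfe,
  swap3 hba, swap3 hca, swap3 hda, comm3 hea, comm3 hfa, comm3 hcb, swap3 hdb, comm3 heb, comm3 hfb, swap3 hdc, swap3 hec, swap3 hfc, comm3 hed, swap3 hfd, swap3 hfe).

Ltac normal := rewrite ?(mulrDl, mulrDr, mulr1, mul1r, scalerDr, mulrA, =^~ scalerAl,
  =^~ scalerAr, scalerA, ordered).

Variables C D G : A.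
Hypotheses (C_def : C = c + q ^+ 2 *: (c * a)) (D_def : D = d + q ^+ 2 *: (d * b)).
Hypothesis G_def : G = q^-1 *: (a * c * d).

Let nilM x y : I 1 x -> I 1 y -> I 1 (x * y).
Proof. by case: filtI => _ _ h _ _ Ix Iy; apply: (h _ 1 1)%N. Qed.

Let IC : I 1 C. Proof. by rewrite C_def; apply: nilD => //; apply/nilZ/nilM. Qed.
Let ID : I 1 D. Proof. by rewrite D_def; apply: nilD => //; apply/nilZ/nilM. Qed.
Let IG : I 1 G. Proof. by rewrite G_def; apply/nilZ/nilM => //; apply/nilM. Qed.

Ltac scalars := first [reflexivity | congr (_ *: _); by field
  | rewrite -[LHS]scale1r; congr (_ *: _); by field
  | rewrite -[RHS]scale1r; congr (_ *: _); by field].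
Ltac monomials := rewrite ?C_def ?D_def ?G_def; normal; rewrite -?addrA;
  first [scalars | congr (_ + _); scalars | rewrite [RHS]addrC; congr (_ + _); scalars].

Let psi2_a_c : psi2 a * c = C * psi2 a.
Proof. rewrite C_def; apply: psi2_qcomm => //; monomials. Qed.

Let psi2_b_d : psi2 b * d = D * psi2 b.
Proof. rewrite D_def; apply: psi2_qcomm => //; monomials. Qed.

Let ev_scale_intertwine cs k x x' y : y * x = x' * y ->
  y * @ev K A N cs (k *: x) = ev N cs (k *: x') * y.
Proof. by move=> h; apply: ev_intertwine; rewrite -scalerAr -scalerAl h. Qed.

(** Undoing the conjugation by psi2(a) turns C back into the monomial c, fixes G and turns D into D
    + q^2 a d, whose two summands q-commute with c in opposite ways, as [psi_split_right]
    requires. *)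
Let D_psi_C : D * psi (q ^+ 2 *: C) =
  psi C * (D + (1 + q ^+ 2) *: G + q ^+ 3 *: (C * G)).
Proof.
pose z := q ^+ 2 *: (a * d).
have Da : D * psi2 a = psi2 a * (D + z).
  have da : d * a = q ^+ 4 *: (a * d) by monomials.
  rewrite D_def mulrDl (psi2_qcomm' Ia da).
  have -> : q ^+ 2 *: (d * b) * psi2 a = psi2 a * (q ^+ 2 *: (d * b)).
    by apply: ev_intertwine; monomials.
  by rewrite -mulrDr addrAC.
have Ga : psi2 a * G = G * psi2 a by apply/esym/ev_intertwine; monomials.
have split : (D + z) * psi (q ^+ 2 *: c) =
    psi c * (D + z + (1 + q ^+ 2) *: G + q ^+ 3 *: (c * G)).
  by apply: psi_split_right => //; rewrite /z; monomials.
apply: (mulIr (psi2_unit Ia)).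
rewrite -mulrA -(ev_scale_intertwine _ _ psi2_a_c) mulrA Da -mulrA split mulrA.
rewrite (ev_intertwine _ _ psi2_a_c) -!mulrA; congr (_ * _).
rewrite 2!mulrDr -Da 2![in RHS]mulrDl -!scalerAr -!scalerAl Ga; congr (_ + _ *: _).
by rewrite mulrA psi2_a_c -!mulrA Ga.
Qed.

(** Now the conjugation by psi2(b) is undone: D becomes the monomial d, G is fixed, and
    [psi_split_left] applies. *)
Let psi_D_C : psi D * C =
  (C + (1 + q ^- 2) *: G + q^-1 *: (G * D)) * psi (q ^- 2 *: D).
Proof.
(* Under this conjugation C becomes c + q^2 c a + q^4 b c a. The outer terms have the same
   commutation with d and are grouped against c a. *)
pose x := c + q ^+ 4 *: (b * c * a); pose z := q ^+ 2 *: (c * a).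
have Cb : C * psi2 b = psi2 b * (x + z).
  have cab : c * a * b = q ^+ 4 *: (b * (c * a)) by monomials.
  rewrite C_def mulrDl -scalerAl (psi2_qcomm' Ib cab).
  have -> : c * psi2 b = psi2 b * c by apply: ev_intertwine.
  rewrite scalerAr -mulrDr; congr (_ * _); rewrite /x /z -addrA; congr (_ + _).
  by rewrite scalerDr addrC scalerA mulrA -exprD.
have Gb : psi2 b * G = G * psi2 b by apply/esym/ev_intertwine; monomials.
have split : psi d * (x + z) =
    (x + z + (1 + q ^- 2) *: G + q^-1 *: (G * d)) * psi (q ^- 2 *: d).
  by apply: psi_split_left => //; rewrite /x /z; monomials.
apply: (mulIr (psi2_unit Ib)).
rewrite -mulrA Cb mulrA -(ev_intertwine _ _ psi2_b_d) -mulrA split mulrA.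
rewrite -[RHS]mulrA -(ev_scale_intertwine _ _ psi2_b_d) mulrA; congr (_ * _).
rewrite 2!mulrDr -Cb 2![in RHS]mulrDl -!scalerAr -!scalerAl Gb; congr (_ + _ *: _).
by rewrite mulrA Gb -!mulrA psi2_b_d.
Qed.

Let G_C : G * C = q ^+ 2 *: (C * G). Proof. by monomials. Qed.
Let D_G : D * G = q ^+ 2 *: (G * D). Proof. by monomials. Qed.
Let f_C : f * C = q ^+ 2 *: (C * f). Proof. by monomials. Qed.
Let D_f : D * f = q ^+ 2 *: (f * D). Proof. by monomials. Qed.
Let G_f : G * f = f * G. Proof. by monomials. Qed.

(** The factor 1 + q C is carried leftwards through psi(D), psi(G) and psi(C). The terms in G
    collected on the way add up to the right side of [D_psi_C], so that D passes psi(C) too. *)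
Let psi_D_E : psi C * psi G * psi D * (1 + q *: C) =
  (1 + q^-1 *: D) * (1 + q *: C) * psi C * psi G * psi (q ^- 2 *: D).
Proof.
have dE : psi D = (1 + q^-1 *: D) * psi (q ^- 2 *: D).
  have -> : q^-1 *: D = q *: (q ^- 2 *: D).
    by rewrite scalerA; congr (_ *: _); field.
  rewrite /psi -(psi_scale c1_rec (nil_expr (nilZ _ ID))).
  by congr ev; rewrite scalerA divff ?expf_neq0 // scale1r.
have step1 : psi D * (1 + q *: C) =
    (1 + q *: C + q^-1 *: ((1 + q *: G) * D) + (q + q^-1) *: G) * psi (q ^- 2 *: D).
  rewrite mulrDr mulr1 -scalerAr psi_D_C dE scalerAl -mulrDl; congr (_ * _).
  rewrite !scalerDr !scalerA divff // scale1r mulrDl mul1r scalerDr -scalerAl.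
  rewrite scalerA mulVf // scale1r -!addrA; congr (1 + _).
  rewrite [LHS]addrCA; congr (_ + (_ + _)); rewrite [LHS]addrC; congr (_ + _ *: _).
  by field.
have step2 : psi G * (1 + q *: C + q^-1 *: ((1 + q *: G) * D) + (q + q^-1) *: G) =
    (1 + q *: C + q^-1 *: (D + (1 + q ^+ 2) *: G + q ^+ 3 *: (C * G))) * psi G.
  (* psi(G) absorbs 1 + q G and becomes psi(q^2 G); carrying D to the front shifts it back to
     psi(G). *)
  have GD : psi G * ((1 + q *: G) * D) = D * psi G.
    have GG : (1 + q *: G) * G = G * (1 + q *: G) by expand.
    rewrite mulrA (psi_comm GG).
    rewrite -(psi_scale c1_rec (nil_expr IG)).
    by apply/esym/ev_intertwine; rewrite D_G scalerAl.
  rewrite !mulrDr -!scalerAr GD (psi_qcomm IG G_C) (psi_comm (erefl (G * G))).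
  rewrite mulr1 -{1}[psi G]mul1r !scalerAl -!mulrDl; congr (_ * _).
  expand; rewrite -!addrA; congr (_ + (_ + _)); rewrite [LHS]addrC -addrA.
  by congr (_ + (_ *: _ + _ *: _)); field.
rewrite -mulrA step1 mulrA -[psi C * _ * _]mulrA step2 mulrA; congr (_ * _ * _).
rewrite 2!mulrDr mulr1 -!scalerAr -D_psi_C /psi (psi_scale c1_rec (nil_expr IC)) -/psi.
rewrite -[RHS]mulrA [(1 + q *: C) * _]mulrDl mul1r -scalerAl.
by rewrite [RHS]mulrDl mul1r -scalerAl (psi_comm (erefl (C * C))).
Qed.

Lemma dilogarithm_reflection :
  psi f * (psi2 b * psi (q^-1 *: (d * f)) / psi2 b) * (psi2 a * psi c / psi2 a) *
    psi (q^-1 *: (a * c * d)) * psi (q^-1 *: (e * f)) *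
    (psi2 b * psi (q ^- 2 *: (d * e * f)) / psi2 b) * psi e =
  psi e * (psi2 a * psi (q^-1 *: (c * e)) / psi2 a) * psi (q ^- 2 *: (a * c * d * e)) *
    psi f * (psi2 b * psi (q^-1 *: (d * f)) / psi2 b) * (psi2 a * psi c / psi2 a) *
    psi (q^-1 *: (a * c * d)).
Proof.
have conj x y y' : I 1 x -> psi2 x * y = y' * psi2 x -> psi2 x * psi y / psi2 x = psi y'.
  by move=> Ix h; rewrite (ev_intertwine _ _ h) mulrK // psi2_unit.
have psi2_b_com y : y * b = b * y -> psi2 b * y = y * psi2 b.
  by move=> h; apply/esym/ev_intertwine.
have psi2_a_com y : y * a = a * y -> psi2 a * y = y * psi2 a.
  by move=> h; apply/esym/ev_intertwine.
have Df : psi2 b * (q^-1 *: (d * f)) = q^-1 *: (D * f) * psi2 b.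
  by rewrite -scalerAl -scalerAr mulrA psi2_b_d -!mulrA psi2_b_com.
have Def : psi2 b * (q ^- 2 *: (d * e * f)) = q^-1 *: (D * (q^-1 *: (e * f))) * psi2 b.
  rewrite -!scalerAr -!scalerAl !scalerA -(mulrA d) [psi2 b * _]mulrA psi2_b_d -!mulrA.
  have efb : e * f * b = b * (e * f) by normal.
  rewrite (psi2_b_com _ efb).
  by rewrite -[X in X *: _ = _]exprVn expr2 !mulrA.
have Ce : psi2 a * (q^-1 *: (c * e)) = q^-1 *: (C * e) * psi2 a.
  by rewrite -scalerAl -scalerAr mulrA psi2_a_c -!mulrA psi2_a_com.
rewrite (conj _ _ _ Ib Df) (conj _ _ _ Ib Def) (conj _ _ _ Ia psi2_a_c) (conj _ _ _ Ia Ce).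
have -> : q ^- 2 *: (a * c * d * e) = q^-1 *: (G * e).
  by rewrite G_def -scalerAl scalerA -exprVn expr2.
rewrite -G_def.
have EF1 : I 1 (q^-1 *: (e * f)) by apply/nilZ/nilM.
apply: (@braid_of_pentagons _ (psi C) (psi G) (psi e) (psi f) (psi D) (psi D)^-1
  _ _ _ _ _ (psi (q^-1 *: (f * C)))).
- by rewrite divrr // psi_unit.
- by apply: psi_pent => //; [apply: nilM | monomials].
- by apply: psi_pent => //; [apply: nilM | monomials].
- by do 2!apply: psi_comm; monomials.
- apply: psi_pent => //; [by apply: nilM | monomials].
- by apply: psi_pent => //; [apply: nilM | monomials].
- by do 2!apply: psi_comm; monomials.
- by do 2!apply: psi_comm; monomials.
have CU := psi_unit IC; have DU := psi_unit ID.
pose M := (psi D)^-1 * (psi C * psi G) * psi D / psi C.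
have MC : psi D * M * psi C = psi C * psi G * psi D.
  by rewrite /M -!mulrA mulVr // mulr1 mulVKr.
have Mf : M * psi f = psi f * M.
  apply: ev_intertwine.
  have ID2 := nilZ (q ^- 2) ID; have D0U := psi_unit ID2.
  have hD : (1 + q^-1 *: D) * psi (q ^- 2 *: D) = psi D.
    have -> : q^-1 *: D = q *: (q ^- 2 *: D) by rewrite scalerA; congr (_ *: _); field.
    rewrite /psi -(psi_scale c1_rec (nil_expr ID2)).
    by congr ev; rewrite scalerA divff ?expf_neq0 // scale1r.
  have fD : f * psi D = psi (q ^- 2 *: D) * f.
    apply: ev_intertwine; rewrite -scalerAl D_f scalerA mulVf ?scale1r //.
    by rewrite expf_neq0.
  have fC : f * psi C = (1 + q *: C) * psi C * f.
    rewrite -(psi_scale c1_rec (nil_expr IC)); apply: ev_intertwine.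
    by rewrite f_C -scalerAl.
  have CC : (1 + q *: C) * psi C = psi C * (1 + q *: C).
    by apply: ev_intertwine; expand.
  have fG : f * psi G = psi G * f by apply: ev_intertwine.
  apply: (mulrI D0U); apply: (mulIr CU).
  transitivity ((1 + q *: C) * (psi C * psi G) * psi (q ^- 2 *: D) * f).
    have inv : psi (q ^- 2 *: D) / psi D * (1 + q^-1 *: D) = 1.
      by rewrite -[LHS](mulrK D0U) -[X in X / _]mulrA hD divrK // divrr.
    have MC' : M * psi C = (psi D)^-1 * (psi C * psi G) * psi D by rewrite /M divrK.
    transitivity (psi (q ^- 2 *: D) / psi D * (psi C * psi G * psi D * (1 + q *: C)) * f).
      by rewrite -[LHS]mulrA -(mulrA M) fC CC (mulrA M) (mulrA M) MC' !mulrA.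
    by rewrite psi_D_E !mulrA inv mul1r.
  rewrite [psi (q ^- 2 *: D) * (f * M)]mulrA -fD -(mulrA f) -(mulrA f) MC !mulrA fC.
  by rewrite -[_ * f * psi G]mulrA fG !mulrA -[_ * f * psi D]mulrA fD !mulrA.
clearbody M.
have pD : psi D * psi f = psi f * psi (q^-1 *: (D * f)) * psi D.
  by apply: psi_pent => //; apply: nilM.
have pC : psi f * psi C = psi C * psi (q^-1 *: (f * C)) * psi f.
  by apply: psi_pent => //; apply: nilM.
have -> : psi f * psi (q^-1 *: (D * f)) = psi D * psi f / psi D by rewrite pD mulrK.
transitivity (psi D * psi f / psi D * (psi D * M * psi C)).
  by rewrite MC !mulrA.
rewrite -MC !mulrA divrK // -[psi D * psi f * M]mulrA -Mf !mulrA.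
by rewrite -[_ * psi f * psi C]mulrA pC !mulrA.
Qed.

End Reflection.

(** * The completed algebra of the Y_i as an algebra of matrices *)

Lemma expCD (R : realType) (z w : R[i]) : expC (z + w) = expC z * expC w.
Proof.
case: z w => [a b] [c d]; rewrite /expC /= expRD cosD sinD; simpc.
congr (_ +i* _); ring.
Qed.

Lemma expC0 (R : realType) : expC (0 : R[i]) = 1.
Proof. by rewrite /expC /= expR0 cos0 sin0; simpc. Qed.

Lemma expC_neq0 (R : realType) (z : R[i]) : expC z != 0.
Proof.
apply/negP => /eqP h; move: (expCD z (- z)); rewrite subrr expC0 h mul0r.
by move/eqP; rewrite oner_eq0.
Qed.

Lemma expCN (R : realType) (z : R[i]) : expC (- z) = (expC z)^-1.
Proof.
by apply: (mulfI (expC_neq0 z)); rewrite -expCD subrr expC0 divff // expC_neq0.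
Qed.

Lemma expCMn (R : realType) (z : R[i]) n : expC (z *+ n) = expC z ^+ n.
Proof. by elim: n => [|n IH]; rewrite ?mulr0n ?expC0 // mulrS expCD IH exprS. Qed.

Lemma expCMz (R : realType) (z : R[i]) (n : int) : expC (z *~ n) = expC z ^ n.
Proof.
case: n => n; first exact: expCMn.
by rewrite NegzE mulrNz expCN -exprnN; congr (_^-1); apply: expCMn.
Qed.

Section Fsbig.
Local Open Scope classical_set_scope.

(** The bridge from sums over sets to finite sums, along a bijection [h] from the indices satisfying
    [P] onto [S]. *)
Lemma fsbig_fintype (V : nmodType) (J : finType) (P : pred J) (T : choiceType)
    (S : set T) (h : J -> T) (F : T -> V) :
  (forall i, P i -> S (h i)) -> {in P &, injective h} ->
  (forall x, S x -> exists2 i, P i & h i = x) ->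
  \sum_(x \in S) F x = \sum_(i | P i) F (h i).
Proof.
move=> hS hI hsurj.
rewrite (reindex_fsbig h [set` P] S); last first.
  split=> [i /hS//|i j|x /hsurj[i Pi <-]]; last by exists i.
  by rewrite !inE; apply: hI.
apply/esym/bigfs; first exact: index_enum_uniq.
by move=> i _; rewrite mem_index_enum.
Qed.

End Fsbig.

Notation expo := {ffun 'I_12 -> nat}.

Definition eadd (k l : expo) : expo := [ffun i => (k i + l i)%N].
Definition esub (k l : expo) : expo := [ffun i => (k i - l i)%N].
Definition emul (n : nat) (k : expo) : expo := [ffun i => (n * k i)%N].
Definition ezero : expo := [ffun=> 0%N].

(** The exponent of q that brings Y^k Y^l into normal order, as in [Amul]. *)
Definition twist (k l : expo) : int :=
  \sum_(i < 12) \sum_(j < 12 | (j < i)%N) bhat2 i j * (k i)%:Z * (l j)%:Z.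

Lemma twistDl k k' l : twist (eadd k k') l = twist k l + twist k' l.
Proof.
rewrite -big_split; apply: eq_bigr => i _; rewrite -big_split; apply: eq_bigr => j _ /=.
by rewrite ffunE PoszD mulrDr mulrDl.
Qed.

Lemma twistDr k l l' : twist k (eadd l l') = twist k l + twist k l'.
Proof.
rewrite -big_split; apply: eq_bigr => i _; rewrite -big_split; apply: eq_bigr => j _ /=.
by rewrite ffunE PoszD mulrDr.
Qed.

Lemma twist0r k : twist k ezero = 0.
Proof. by apply: big1 => i _; apply: big1 => j _; rewrite ffunE mulr0. Qed.

Lemma twist0l k : twist ezero k = 0.
Proof. by apply: big1 => i _; apply: big1 => j _; rewrite ffunE mulr0 mul0r. Qed.

Section Box.
Variables (R : realType) (hbar : R[i]) (K : nat).
Let q := expC hbar.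

Definition box_exp := {ffun 'I_12 -> 'I_K.+1}.
Definition unbox (b : box_exp) : expo := [ffun i => nat_of_ord (b i)].
(** A predecessor, so that the matrices of size [box_dim.+1] form a nonzero ring. *)
Definition box_dim := #|{: box_exp}|.-1.
Definition box (i : 'I_box_dim.+1) : box_exp := nth [ffun=> ord0] (enum box_exp) i.
Definition unbox_le (b c : box_exp) := [forall i, (b i <= c i)%N].

Lemma box_dimE : box_dim.+1 = #|{: box_exp}|.
Proof. by rewrite prednK //; apply/card_gt0P; exists [ffun=> ord0]. Qed.

Lemma box_surj b : exists i, box i = b.
Proof.
have h : (index b (enum box_exp) < box_dim.+1)%N.
  by rewrite box_dimE cardE index_mem mem_enum.
by exists (Ordinal h); rewrite /box /= nth_index // mem_enum.
Qed.

Lemma box_inj : injective box.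
Proof.
move=> i j /eqP; rewrite nth_uniq ?enum_uniq -?cardE -?box_dimE //.
by move=> /eqP /val_inj.
Qed.

Lemma sum_box (V : nmodType) (F : box_exp -> V) :
  \sum_(i < box_dim.+1) F (box i) = \sum_b F b.
Proof.
rewrite -[RHS]big_enum (big_nth [ffun=> ord0]) -cardE -box_dimE.
by rewrite big_mkord.
Qed.

(** The coefficient of Y^b in the product of a and Y^c. *)
Definition box_coef (a : Aseries R) (b c : box_exp) : R[i] :=
  if unbox_le c b then
    a (esub (unbox b) (unbox c)) * q ^ twist (esub (unbox b) (unbox c)) (unbox c)
  else 0.

(* Left multiplication by a on the quotient by the ideal of the monomials with
   some exponent above K. *)
Definition box_mx (a : Aseries R) : 'M[R[i]]_(box_dim.+1) :=
  \matrix_(i, j) box_coef a (box i) (box j).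

Lemma q_neq0 : q != 0. Proof. exact: expC_neq0. Qed.

Lemma unbox_leP (b c : box_exp) : reflect (forall i, (b i <= c i)%N) (unbox_le b c).
Proof. exact: forallP. Qed.

(** Since exponents only grow, the terms of [Amul] correspond to the intermediate exponents between
    m and n in the matrix product. The powers of q agree by bilinearity of [twist]. *)
Lemma box_mxM (a b : Aseries R) : box_mx (Amul hbar a b) = box_mx a * box_mx b.
Proof.
apply/matrixP => i j; rewrite !mxE.
under eq_bigr do rewrite !mxE.
rewrite (sum_box (fun k => box_coef a (box i) k * box_coef b k (box j))).
move: (box i) (box j) => {i j} n m.
rewrite [LHS]/box_coef; case: ifPn => [mn|nmn]; last first.
  rewrite big1 // => k _; rewrite /box_coef.
  case: ifP => [/unbox_leP kn|]; last by rewrite mul0r.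
  case: ifP => [/unbox_leP mk|]; last by rewrite mulr0.
  case/negP: nmn; apply/unbox_leP => i; exact: leq_trans (mk i) (kn i).
pose P k := unbox_le m k && unbox_le k n.
rewrite /Amul (fsbig_fintype (P := P)
  (h := fun k => (esub (unbox n) (unbox k), esub (unbox k) (unbox m)))).
- rewrite mulr_suml [RHS](bigID P) /= [X in _ + X]big1 ?addr0; last first.
    move=> k; rewrite negb_and /box_coef => /orP[/negbTE->|/negbTE->].
      by rewrite mulr0.
    by rewrite mul0r.
  apply: eq_bigr => k /andP[mk kn]; rewrite /box_coef mk kn.
  rewrite -/(twist _ _) -/q.
  have kE : unbox k = eadd (esub (unbox k) (unbox m)) (unbox m).
    by apply/ffunP => i; rewrite !ffunE subnK //; apply/unbox_leP.
  have nE : esub (unbox n) (unbox m) =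
      eadd (esub (unbox n) (unbox k)) (esub (unbox k) (unbox m)).
    apply/ffunP => i; rewrite !ffunE addnBA ?subnK //; first exact: (unbox_leP _ _ kn).
    exact: (unbox_leP _ _ mk).
  have t1 : q ^ twist (esub (unbox n) (unbox k)) (unbox k) =
      q ^ twist (esub (unbox n) (unbox k)) (esub (unbox k) (unbox m)) *
      q ^ twist (esub (unbox n) (unbox k)) (unbox m).
    by rewrite {2}kE twistDr expfzDr ?q_neq0.
  rewrite t1 nE twistDl expfzDr ?q_neq0 //.
  by rewrite -!mulrA; congr (_ * _); rewrite mulrCA; congr (_ * _); rewrite mulrCA.
- move=> k /andP[/unbox_leP mk /unbox_leP kn] i /=; rewrite !ffunE addnBA // subnK //.
- move=> k k' /andP[/unbox_leP mk /unbox_leP kn] /andP[/unbox_leP mk' /unbox_leP kn'].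
  move=> [_ /ffunP h]; apply/ffunP => i; apply/val_inj => /=.
  by move: (h i); rewrite !ffunE => /(congr1 (addn^~ (m i))); rewrite !subnK.
move=> [k l] /= h.
have lt i : (l i + m i < K.+1)%N.
  move: (h i); rewrite ffunE => e; apply: leq_ltn_trans (ltn_ord (n i)).
  rewrite -(subnK (unbox_leP _ _ mn i)) leq_add2r; move: e; rewrite !ffunE => <-.
  exact: leq_addl.
exists [ffun i => Ordinal (lt i)].
  apply/andP; split; apply/unbox_leP => i; rewrite !ffunE /= ?leq_addl //.
  rewrite -(subnK (unbox_leP _ _ mn i)) leq_add2r; move: (h i); rewrite !ffunE => <-.
  exact: leq_addl.
congr (_, _); apply/ffunP => i; rewrite !ffunE /= ?addnK //.
move: (h i); rewrite !ffunE => e.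
by rewrite [(l i + _)%N]addnC subnDA -e addnK.
Qed.

Lemma box_mx1 : box_mx (Aone R) = 1.
Proof.
apply/matrixP => i j; rewrite !mxE /box_coef /Aone.
have [->|nij] := eqVneq i j.
  rewrite ifT; last by apply/unbox_leP.
  have -> : esub (unbox (box j)) (unbox (box j)) = ezero.
    by apply/ffunP => k; rewrite !ffunE subnn.
  have e0 : [forall i, ezero i == 0%N] by apply/forallP => k; rewrite ffunE.
  by rewrite twist0l expr0z mulr1 e0.
have [/unbox_leP ji|//] := boolP (unbox_le (box j) (box i)).
case: forallP => [h|_]; last by rewrite mul0r.
case/eqP: nij; apply: box_inj; apply/ffunP => k; apply/val_inj/eqP.
rewrite eqn_leq ji andbT -subn_eq0.
by move: (h k); rewrite !ffunE.
Qed.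

End Box.

(** The column of the monomial 1 lists the coefficients, and every exponent lies in some box. *)
Lemma box_mx_inj (R : realType) (hbar : R[i]) (a b : Aseries R) :
  (forall K, box_mx hbar K a = box_mx hbar K b) -> a = b.
Proof.
move=> h; apply/funext => n.
pose K := (\max_i n i)%N.
have lt i : (n i < K.+1)%N by rewrite ltnS; apply: leq_bigmax.
pose nb : box_exp K := [ffun i => Ordinal (lt i)].
have [i ib] := box_surj nb; have [j jb] := box_surj ([ffun=> ord0] : box_exp K).
have := congr1 (fun M => fun_of_matrix M i j) (h K).
rewrite !mxE /box_coef ib jb.
have -> : unbox ([ffun=> ord0] : box_exp K) = ezero by apply/ffunP => k; rewrite !ffunE.
rewrite twist0r expr0z !mulr1.
have -> : esub (unbox nb) ezero = n by apply/ffunP => k; rewrite !ffunE subn0.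
have -> : unbox_le [ffun=> ord0] nb by apply/unbox_leP => k; rewrite !ffunE.
by [].
Qed.

(** * Conjugation of linear forms *)

Section Omega.

Lemma omegaDl m n l : omega (m + n) l = omega m l + omega n l.
Proof. by rewrite -big_split; apply: eq_bigr => i _ /=; rewrite !mxE; ring. Qed.

Lemma omegaC m n : omega m n = - omega n m.
Proof. by rewrite -sumrN; apply: eq_bigr => i _; ring. Qed.

Lemma omegaDr m n l : omega l (m + n) = omega l m + omega l n.
Proof. by rewrite omegaC omegaDl opprD -!omegaC. Qed.

Lemma omegaNl m l : omega (- m) l = - omega m l.
Proof. by rewrite -sumrN; apply: eq_bigr => i _ /=; rewrite !mxE; ring. Qed.

Lemma omega0l l : omega 0 l = 0.
Proof. by apply: big1 => i _; rewrite !mxE; ring. Qed.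

Lemma omegaMnl m l n : omega (m *+ n) l = omega m l *+ n.
Proof. by elim: n => [|n IH]; rewrite ?mulr0n ?omega0l // !mulrS omegaDl IH. Qed.

Lemma omegaMnr m l n : omega m (l *+ n) = omega m l *+ n.
Proof. by rewrite omegaC omegaMnl -mulNrn -omegaC. Qed.

Lemma omegaMzl m l z : omega (m *~ z) l = omega m l *~ z.
Proof. by case: z => n; rewrite -?pmulrn ?NegzE ?mulrNz ?omegaNl omegaMnl. Qed.

Lemma omegaMzr m l z : omega m (l *~ z) = omega m l *~ z.
Proof. by rewrite omegaC omegaMzl -mulNrz -omegaC. Qed.

Lemma omega0r l : omega l 0 = 0.
Proof. by rewrite omegaC omega0l oppr0. Qed.

Lemma omega_sumr (J : Type) (r : seq J) (P : pred J) (F : J -> lat) l :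
  omega l (\sum_(j <- r | P j) F j) = \sum_(j <- r | P j) omega l (F j).
Proof. by elim/big_rec2: _ => [|j x y _ <-]; rewrite ?omega0r ?omegaDr. Qed.

Lemma omega_suml (J : Type) (r : seq J) (P : pred J) (F : J -> lat) l :
  omega (\sum_(j <- r | P j) F j) l = \sum_(j <- r | P j) omega (F j) l.
Proof. by rewrite omegaC omega_sumr -sumrN; apply: eq_bigr => j _; rewrite -omegaC. Qed.

Lemma omegaxx m : omega m m = 0.
Proof. by apply: big1 => i _; rewrite [X in _ - X]mulrC subrr mulr0. Qed.

Lemma omega_p i l : omega (delta_mx 0 i, 0) l = wt i * l.2 0 i.
Proof.
rewrite /omega (bigD1 i) //= !mxE !eqxx big1 ?addr0 /=.
  by rewrite mul1r mul0r subr0.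
by move=> j ji; rewrite !mxE (negbTE ji) /= !mul0r subrr mulr0.
Qed.

Lemma omega_u (v : 'rV[int]_9) l : omega (0, v) l = - \sum_j wt j * v 0 j * l.1 0 j.
Proof. by rewrite -sumrN; apply: eq_bigr => i _ /=; rewrite !mxE; ring. Qed.

Lemma omega_uf i l : omega (0, delta_mx 0 i) l = - (wt i * l.1 0 i).
Proof.
rewrite omega_u (bigD1 i) //= !mxE !eqxx big1 ?addr0 /= ?mulr1 //.
by move=> j ji; rewrite !mxE (negbTE ji) /= mulr0 mul0r.
Qed.

End Omega.

(** * Symplectic maps of linear forms *)

Section Operators.
Variables (R : realType).
Local Notation lform := (lform R).
Local Notation lcst := (@Defs.cst R).

(** What the adjoint actions of all the operators share: it is stable under composition and suffices
    for [AdF] to be multiplicative. *)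
Definition symplectic (F : lform -> lform) : Prop :=
  [/\ forall L M, F (L + M) = F L + F M,
      forall x : R[i], F (lcst x) = lcst x,
      forall L M, omega (F L).1 (F M).1 = omega L.1 M.1 &
      exists G : lform -> lform, cancel F G /\ cancel G F].

Lemma symplectic_id : symplectic id.
Proof. by split=> //; exists id. Qed.

Lemma symplectic_comp F G : symplectic F -> symplectic G -> symplectic (F \o G).
Proof.
move=> [FD Fc Fo [F' [FK KF]]] [GD Gc Go [G' [GK KG]]]; split => /=.
- by move=> L M; rewrite GD FD.
- by move=> x; rewrite Gc Fc.
- by move=> L M; rewrite Fo Go.
by exists (G' \o F'); split=> L /=; rewrite ?FK ?KG.
Qed.

Lemma lform1D (L M : lform) : (L + M).1 = L.1 + M.1. Proof. by []. Qed.

Lemma lform1Mz (L : lform) z : (L *~ z).1 = L.1 *~ z.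
Proof. exact: (raddfMz fst). Qed.

Lemma lform1Mn (L : lform) n : (L *+ n).1 = L.1 *+ n.
Proof. exact: (raddfMn fst). Qed.

Lemma lcstD x y : lcst (x + y) = lcst x + lcst y.
Proof. by rewrite /Defs.cst /=; congr (_, _, _); rewrite addr0. Qed.

Lemma lform_split (L : lform) : L = (L.1, 0) + lcst L.2.
Proof.
case: L => [[p u] x]; rewrite /Defs.cst /= /GRing.add /=.
by congr (_, _, _); rewrite ?addr0 ?add0r.
Qed.

Lemma omega_uu (v w : 'rV[int]_9) : omega (0, v) (0, w) = 0.
Proof. by rewrite omega_u big1 ?oppr0 // => j _; rewrite mxE mulr0. Qed.

Lemma omega_add_mz (a b c d e f : lat) x y z t :
  omega (a + b *~ x + c *~ y) (d + e *~ z + f *~ t) =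
  omega a d + omega a e *~ z + omega a f *~ t +
  (omega b d + omega b e *~ z + omega b f *~ t) *~ x +
  (omega c d + omega c e *~ z + omega c f *~ t) *~ y.
Proof.
rewrite 2!omegaDl (omegaMzl b) (omegaMzl c).
rewrite (omegaDr _ _ a) (omegaDr _ _ b) (omegaDr _ _ c).
rewrite (omegaDr _ _ a) (omegaDr _ _ b) (omegaDr _ _ c).
by rewrite (omegaMzr a e) (omegaMzr a f) (omegaMzr b e) (omegaMzr b f) (omegaMzr c e)
  (omegaMzr c f).
Qed.

(** Conjugation by e^(P V / hbar) when P and V commute. Arbitrary forms in place of p_i and a
    combination of the u_j make the class stable under symplectic maps, in particular under
    relabelling. *)
Definition transvection (P V : lform) (L : lform) : lform :=
  L + V *~ omega P.1 L.1 + P *~ omega V.1 L.1.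

Lemma transvection1 P V L :
  (transvection P V L).1 = L.1 + V.1 *~ omega P.1 L.1 + P.1 *~ omega V.1 L.1.
Proof. by rewrite /transvection !lform1D !lform1Mz. Qed.

Lemma omega_transvection P V L (m : lat) :
  omega m (transvection P V L).1 =
  omega m L.1 + omega m V.1 *~ omega P.1 L.1 + omega m P.1 *~ omega V.1 L.1.
Proof.
rewrite transvection1 omegaDr (omegaDr L.1).
by rewrite (omegaMzr m V.1) (omegaMzr m P.1).
Qed.

(** The products P V and P W commute, so the exponents add. *)
Lemma transvectionD P V W L : omega P.1 V.1 = 0 -> omega P.1 W.1 = 0 -> omega V.1 W.1 = 0 ->
  transvection P V (transvection P W L) = transvection P (V + W) L.
Proof.
move=> pv pw vw; have vp : omega V.1 P.1 = 0 by rewrite omegaC pv oppr0.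
rewrite {1}/transvection 2!omega_transvection pw vp vw omegaxx.
rewrite !mul0rz !addr0 /transvection lform1D omegaDl mulrzDr mulrzDl -!addrA; congr (_ + _).
rewrite [RHS]addrCA; congr (_ + _); rewrite addrCA; congr (_ + _).
by rewrite addrC.
Qed.

Lemma transvection0 P L : transvection P 0 L = L.
Proof. by rewrite /transvection mul0rz omega0l mulr0z !addr0. Qed.

Lemma transvection_symplectic P V : omega P.1 V.1 = 0 -> symplectic (transvection P V).
Proof.
move=> pv; have vp : omega V.1 P.1 = 0 by rewrite omegaC pv oppr0.
split=> [L M|x|L M|].
- rewrite /transvection !lform1D (omegaDr L.1 _ P.1) (omegaDr L.1 _ V.1) !mulrzDr.
  by rewrite [RHS]addrACA [X in _ = X + _]addrACA.
- by rewrite /transvection !omega0r !mulr0z !addr0.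
- rewrite 2!transvection1 omega_add_mz pv vp !omegaxx !mul0rz !addr0.
  rewrite (omegaC L.1 V.1) (omegaC L.1 P.1).
  move: (omega P.1 L.1) (omega V.1 L.1) (omega P.1 M.1) (omega V.1 M.1) (omega L.1 M.1).
  by move=> a b c d e; rewrite !mulrzz; ring.
exists (transvection P (- V)); have nv : omega P.1 (- V).1 = 0.
  by rewrite omegaC [(- V).1]/(- V.1) omegaNl vp !oppr0.
have vv : omega (- V).1 V.1 = 0 by rewrite [(- V).1]/(- V.1) omegaNl omegaxx oppr0.
split=> L; rewrite transvectionD ?addNr ?subrr ?transvection0 //.
by rewrite omegaC vv oppr0.
Qed.

Section Symplectic.
Variable F : lform -> lform.
Hypothesis symF : symplectic F.

Lemma symplecticD L M : F (L + M) = F L + F M. Proof. by case: symF. Qed.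
Lemma symplectic_cst x : F (lcst x) = lcst x. Proof. by case: symF. Qed.
Lemma symplectic_omega L M : omega (F L).1 (F M).1 = omega L.1 M.1.
Proof. by case: symF. Qed.

Lemma symplectic0 : F 0 = 0.
Proof. by apply: (addrI (F 0)); rewrite -symplecticD !addr0. Qed.

Lemma symplecticN L : F (- L) = - F L.
Proof. by apply: (addrI (F L)); rewrite -symplecticD !subrr symplectic0. Qed.

Lemma symplecticMn L n : F (L *+ n) = F L *+ n.
Proof. by elim: n => [|n IH]; rewrite ?mulr0n ?symplectic0 // !mulrS symplecticD IH. Qed.

Lemma symplecticMz L z : F (L *~ z) = F L *~ z.
Proof. by case: z => n; rewrite ?NegzE ?mulrNz ?symplecticN -!pmulrn symplecticMn. Qed.

Lemma symplectic_transvection P V L :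
  F (transvection P V L) = transvection (F P) (F V) (F L).
Proof.
rewrite /transvection 2!symplecticD (symplecticMz V) (symplecticMz P).
by rewrite (symplectic_omega P) (symplectic_omega V).
Qed.

End Symplectic.

Definition uform (v : 'rV[int]_9) : lform := (0, v, 0).

Lemma exp_puE i v : (exp_pu R i v).2 = transvection (pf R i) (uform v).
Proof. by []. Qed.

Lemma omega_pu i (v : 'rV[int]_9) : v 0 i = 0 -> omega (pf R i).1 (uform v).1 = 0.
Proof. by move=> vi; rewrite omega_p vi mulr0. Qed.

Lemma uformD v w : uform (v + w) = uform v + uform w.
Proof. by rewrite /uform /GRing.add /=; congr (_, _, _); rewrite addr0. Qed.

Lemma exp_puD i (v w : 'rV[int]_9) : v 0 i = 0 -> w 0 i = 0 ->
  Nmul (exp_pu R i v) (exp_pu R i w) = exp_pu R i (v + w).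
Proof.
move=> /omega_pu pv /omega_pu pw; rewrite /Nmul mulr1; congr (_, _).
apply/funext => L; apply: etrans (transvectionD L pv pw (omega_uu v w)) _.
by rewrite -uformD.
Qed.

Lemma exp_pu_symplectic i (v : 'rV[int]_9) : v 0 i = 0 -> symplectic (exp_pu R i v).2.
Proof. by move=> vi; rewrite exp_puE; apply/transvection_symplectic/omega_pu. Qed.

Lemma exp_uD (a b : 'rV[R[i]]_9) : Nmul (exp_u a) (exp_u b) = exp_u (a + b).
Proof.
rewrite /Nmul /exp_u /= mulr1; congr (_, _); apply/funext => L /=.
rewrite -addrA -lcstD -big_split; congr (_ + lcst _); apply: eq_bigr => j _ /=.
by rewrite mxE mulrDl omegaDr omega0r addr0 addrC.
Qed.

Lemma exp_u0 : (exp_u (0 : 'rV[R[i]]_9)).2 = id.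
Proof.
apply/funext => L; rewrite /exp_u /= big1 ?addr0 // => j _.
by rewrite mxE mul0r.
Qed.

Lemma exp_u_symplectic (a : 'rV[R[i]]_9) : symplectic (exp_u a).2.
Proof.
split=> /=.
- move=> L M; rewrite addrACA -lcstD -big_split /=; congr (_ + lcst _).
  by apply: eq_bigr => j _; rewrite omegaDr intrD mulrDr.
- by move=> x; rewrite big1 ?addr0 // => j _; rewrite omega0r mulr0.
- by move=> L M; rewrite !addr0.
exists (exp_u (- a)).2; split=> L.
  by have := congr1 (fun f => f.2 L) (exp_uD (- a) a); rewrite addNr exp_u0.
by have := congr1 (fun f => f.2 L) (exp_uD a (- a)); rewrite subrr exp_u0.
Qed.

Lemma permL_comp s t (L : lform) : permL s (permL t L) = permL (t * s)%g L.
Proof. by congr (_, _, _); apply/rowP => j; rewrite !mxE invMg permM. Qed.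

Lemma permL1 (L : lform) : permL 1%g L = L.
Proof.
case: L => [[p u] x]; congr (_, _, _); apply/rowP => j; rewrite mxE invg1 perm1 //.
Qed.

Lemma permL_symplectic (s : 'S_9) : (forall i, wt (s i) = wt i) -> symplectic (@permL R s).
Proof.
move=> ws; split.
- by move=> L M; congr (_, _, _); apply/rowP => j; rewrite !mxE.
- by move=> x; congr (_, _, _); apply/rowP => j; rewrite !mxE.
- move=> L M; rewrite /omega (reindex_inj (@perm_inj _ s)); apply: eq_bigr => i _.
  by rewrite !mxE permK ws.
exists (permL s^-1%g); split=> L; rewrite permL_comp ?mulgV ?mulVg permL1 //.
Qed.

Lemma Ad_mul (x y : NSelt R) : Ad (NSmul x y) = Ad x \o Ad y.
Proof.
apply/funext => L; rewrite /Ad /NSmul /permN /= permL_comp; congr (x.1.2 (permL _ (y.1.2 _))).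
by rewrite -mulgA mulgV mulg1.
Qed.

Lemma AdE (x : NSelt R) : x.1.2 = Ad x \o permL (x.2^-1)%g.
Proof. by apply/funext => L; rewrite /Ad /= permL_comp mulVg permL1. Qed.

Lemma Ad_one : Ad (NSone R) = id.
Proof. by apply/funext => L; rewrite /Ad /= permL1. Qed.

Lemma tperm_wt j k : wt j = wt k -> forall i, wt (tperm j k i) = wt i.
Proof. by move=> h i; case: tpermP => [->|->|]. Qed.

Lemma Ad_ofN (x : Nelt R) : Ad (ofN x) = x.2.
Proof. by apply/funext => L; rewrite /Ad /comp permL1. Qed.

Lemma Ad_rho j k : Ad (rho R j k) = permL (tperm j k).
Proof. by []. Qed.

Lemma Ad_P lam i j k : Ad (Pop lam i j k) = permL (tperm j k) \o
  (exp_pu R i (delta_mx 0 k - delta_mx 0 j)).2 \o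
  (exp_u ((lam j - lam k) *: (delta_mx 0 k - delta_mx 0 i))).2.
Proof. by rewrite 2!Ad_mul 2!Ad_ofN Ad_rho. Qed.

Lemma Ad_PK lam i j k l : Ad (PKop lam i j k l) = permL (tperm j l) \o
  (exp_pu R i (delta_mx 0 l - delta_mx 0 j)).2 \o
  (exp_u (((lam j - lam l) / 2) *:
     (2 *: delta_mx 0 k - 2 *: delta_mx 0 i + delta_mx 0 l - delta_mx 0 j))).2.
Proof. by rewrite 2!Ad_mul 2!Ad_ofN Ad_rho. Qed.

Lemma diff_delta (i j k : 'I_9) : i != j -> i != k ->
  (delta_mx 0 k - delta_mx 0 j : 'rV[int]_9) 0 i = 0.
Proof. by move=> /negbTE ij /negbTE ik; rewrite !mxE ij ik subrr. Qed.

Lemma P_symplectic lam i j k : i != j -> i != k -> wt j = wt k ->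
  symplectic (Ad (Pop lam i j k)).
Proof.
move=> ij ik /tperm_wt jk; rewrite Ad_P.
apply: symplectic_comp; last exact: exp_u_symplectic.
apply: symplectic_comp; first exact: permL_symplectic.
by apply: exp_pu_symplectic; apply: diff_delta.
Qed.

Lemma PK_symplectic lam i j k l : i != j -> i != l -> wt j = wt l ->
  symplectic (Ad (PKop lam i j k l)).
Proof.
move=> ij ik /tperm_wt jk; rewrite Ad_PK.
apply: symplectic_comp; last exact: exp_u_symplectic.
apply: symplectic_comp; first exact: permL_symplectic.
by apply: exp_pu_symplectic; apply: diff_delta.
Qed.

End Operators.

(** * Membership in the group and equality of its elements *)

Section Membership.
Variable R : realType.

Lemma inN_one : inN ((1, id) : Nelt R).
Proof. exact/inN_cst/oner_neq0. Qed.

Lemma inN_exp_u (a : 'rV[R[i]]_9) : inN (exp_u a).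
Proof.
rewrite [a]row_sum_delta; elim/big_rec: _ => [|j x _ IH].
  rewrite (_ : exp_u _ = (1, id)); first exact: inN_one.
  by rewrite -(exp_u0 R).
by rewrite -exp_uD; apply: inN_mul => //; apply: inN_u.
Qed.

Lemma inN_exp_pu i j k : i != j -> i != k ->
  inN (exp_pu R i (delta_mx 0 k - delta_mx 0 j)).
Proof.
move=> ij ik; have [ji ki] := (negbTE ij, negbTE ik).
rewrite -exp_puD ?mxE ?ji ?ki ?oppr0 //.
by apply: inN_mul; [apply: inN_pu | apply: inN_puV].
Qed.

Lemma permL_p (s : 'S_9) i : permL s (pf R i) = pf R (s i).
Proof.
congr (_, _, _); apply/rowP => j; rewrite !mxE //=.
by rewrite -(inj_eq (@perm_inj _ s)) permKV.
Qed.

Lemma permL_u (s : 'S_9) i : permL s (uf R i) = uf R (s i).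
Proof.
congr (_, _, _); apply/rowP => j; rewrite !mxE //=.
by rewrite -(inj_eq (@perm_inj _ s)) permKV.
Qed.

Lemma permN_transvection (s : 'S_9) (x : Nelt R) P V : (forall i, wt (s i) = wt i) ->
  x.2 = transvection P V -> permN s x = (x.1, transvection (permL s P) (permL s V)).
Proof.
move=> /(permL_symplectic R) S xE; rewrite /permN xE; apply: (congr1 (pair _)); apply/funext => L.
by rewrite /comp (symplectic_transvection S) permL_comp mulVg permL1.
Qed.

Lemma permN_pu (s : 'S_9) i (v : 'rV[int]_9) : (forall i, wt (s i) = wt i) ->
  permN s (exp_pu R i v) = exp_pu R (s i) (\row_j v 0 ((s^-1)%g j)).
Proof.
move=> hs; rewrite (permN_transvection hs (exp_puE R i v)) permL_p.
have -> : permL s (uform R v) = uform R (\row_j v 0 ((s^-1)%g j)).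
  by congr (_, _, _); apply/rowP => j; rewrite !mxE.
by [].
Qed.

Definition u_shift (a : 'rV[R[i]]_9) (L : lform R) : lform R :=
  L + Defs.cst (\sum_(j < 9) a 0 j * (omega (uf R j).1 L.1)%:~R).

Lemma permN_shift (s : 'S_9) (x : Nelt R) a : (forall i, wt (s i) = wt i) ->
  x.2 = u_shift a -> permN s x = (x.1, u_shift (\row_j a 0 ((s^-1)%g j))).
Proof.
move=> /(permL_symplectic R) S xE; rewrite /permN xE; apply: (congr1 (pair _)); apply/funext => L.
rewrite /comp /u_shift (symplecticD S) (symplectic_cst S) permL_comp mulVg permL1.
congr (_ + Defs.cst _); rewrite [RHS](reindex_inj (@perm_inj _ s)); apply: eq_bigr => j _.
rewrite mxE permK -permL_u.
by rewrite -(symplectic_omega S _ (permL _ L)) permL_comp mulVg permL1.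
Qed.

Lemma permN_u (s : 'S_9) (a : R[i]) i : (forall i, wt (s i) = wt i) ->
  permN s (exp_u (a *: delta_mx 0 i)) = exp_u (a *: delta_mx 0 (s i)).
Proof.
move=> hs; rewrite (permN_shift (a := a *: delta_mx 0 i) hs) //.
have -> : \row_j (a *: delta_mx 0 i : 'rV[R[i]]_9) 0 ((s^-1)%g j) =
      (a *: delta_mx 0 (s i) : 'rV[R[i]]_9).
  by apply/rowP => j; rewrite !mxE -(inj_eq (@perm_inj _ s)) permKV.
by [].
Qed.

(** Relabelling sends generators to generators. The weights must be preserved because the action of
    a generator involves [wt] through [omega]. *)
Lemma inN_perm (s : 'S_9) (x : Nelt R) : (forall i, wt (s i) = wt i) ->
  inN x -> inN (permN s x).
Proof.
move=> hs.
have dE i : (\row_j (delta_mx 0 i : 'rV[int]_9) 0 ((s^-1)%g j)) = delta_mx 0 (s i).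
  by apply/rowP => j; rewrite !mxE -(inj_eq (@perm_inj _ s)) permKV.
elim=> [i j ij|i j ij|a i|b b0|y z _ IHy _ IHz].
- rewrite permN_pu // dE; apply: inN_pu; by rewrite (inj_eq (@perm_inj _ s)).
- rewrite permN_pu //.
  have -> : \row_k (- delta_mx 0 j : 'rV[int]_9) 0 ((s^-1)%g k) = - delta_mx 0 (s j).
    by rewrite -dE; apply/rowP => k; rewrite !mxE.
  by apply: inN_puV; rewrite (inj_eq (@perm_inj _ s)).
- by rewrite permN_u //; apply: inN_u.
- rewrite (_ : permN s _ = (b, id)); first exact: inN_cst.
  by rewrite /permN /=; congr (_, _); apply/funext => L /=; rewrite permL_comp mulVg permL1.
rewrite (_ : permN s _ = Nmul (permN s y) (permN s z)); first exact: inN_mul.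
rewrite /permN /Nmul /=; congr (_, _); apply/funext => L /=.
by rewrite permL_comp mulgV permL1.
Qed.

Lemma inNS_mul (x y : NSelt R) : inNS x -> inNS y -> inNS (NSmul x y).
Proof.
move=> [x1 x2] [y1 y2]; split; last by move=> i; rewrite /= permM x2 y2.
by apply: inN_mul => //; apply: inN_perm.
Qed.

Lemma inNS_ofN (x : Nelt R) : inN x -> inNS (ofN x).
Proof. by move=> h; split=> // i; rewrite /= perm1. Qed.

Lemma inNS_rho j k : wt j = wt k -> inNS (rho R j k).
Proof. by move=> h; split; [exact: inN_one | exact: tperm_wt]. Qed.

Lemma inNS_P lam i j k : i != j -> i != k -> wt j = wt k -> inNS (@Pop R lam i j k).
Proof.
move=> ij ik jk; apply: inNS_mul; first apply: inNS_mul.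
- exact: inNS_rho.
- exact/inNS_ofN/inN_exp_pu.
exact/inNS_ofN/inN_exp_u.
Qed.

Lemma inNS_PK lam i j k l : i != j -> i != l -> wt j = wt l ->
  inNS (@PKop R lam i j k l).
Proof.
move=> ij ik jk; apply: inNS_mul; first apply: inNS_mul.
- exact: inNS_rho.
- exact/inNS_ofN/inN_exp_pu.
exact/inNS_ofN/inN_exp_u.
Qed.

(** The action of the first component is recovered from [Ad] and the permutation. *)
Lemma NSelt_eq (x y : NSelt R) : x.1.1 = y.1.1 -> Ad x = Ad y -> x.2 = y.2 -> x = y.
Proof.
move=> h1 h2 h3; have := AdE x; have := AdE y; rewrite h2 h3 => <-.
by case: x y h1 h2 h3 => [[? ?] ?] [[? ?] ?] /= -> _ -> ->.
Qed.

Lemma morph_mulrz (U V : zmodType) (f : U -> V) :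
  {morph f : x y / x + y} -> forall x z, f (x *~ z) = f x *~ z.
Proof.
move=> fD; have f0 : f 0 = 0 by apply: (addrI (f 0)); rewrite -fD !addr0.
have fN x : f (- x) = - f x by apply: (addrI (f x)); rewrite -fD !subrr.
have fMn x n : f (x *+ n) = f x *+ n.
  by elim: n => [|n IH]; rewrite ?mulr0n // !mulrS fD IH.
by move=> x [] n; rewrite ?NegzE ?mulrNz ?fN -!pmulrn fMn.
Qed.

Lemma row_deltaE (v : 'rV[int]_9) : v = \sum_j delta_mx 0 j *~ v 0 j.
Proof.
rewrite {1}[v]row_sum_delta; apply: eq_bigr => j _.
by rewrite -scaler_int intz.
Qed.

Lemma lform_sum (L : lform R) :
  L = \sum_j pf R j *~ L.1.1 0 j + \sum_j uf R j *~ L.1.2 0 j + Defs.cst L.2.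
Proof.
pose inp (v : 'rV[int]_9) : lform R := (v, 0, 0).
pose inu (v : 'rV[int]_9) : lform R := (0, v, 0).
have inpD : {morph inp : v w / v + w}.
  by move=> v w; rewrite /inp /GRing.add /=; congr (_, _, _); rewrite addr0.
have inuD : {morph inu : v w / v + w}.
  by move=> v w; rewrite /inu /GRing.add /=; congr (_, _, _); rewrite addr0.
have e1 : \sum_j pf R j *~ L.1.1 0 j = inp L.1.1.
  rewrite [in RHS](row_deltaE L.1.1) (big_morph inp inpD (erefl _)).
  by apply: eq_bigr => j _; rewrite (morph_mulrz inpD).
have e2 : \sum_j uf R j *~ L.1.2 0 j = inu L.1.2.
  rewrite [in RHS](row_deltaE L.1.2) (big_morph inu inuD (erefl _)).
  by apply: eq_bigr => j _; rewrite (morph_mulrz inuD).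
apply: etrans _ (congr1 (+%R^~ (Defs.cst L.2)) (congr2 +%R (esym e1) (esym e2))).
rewrite {1}[L]lform_split; apply: (congr1 (+%R^~ _)).
move: L {e1 e2} => [[p u] x]; rewrite /fst /snd.
by rewrite /inp /inu /GRing.add /=; congr (_, _, _); rewrite ?addr0 ?add0r.
Qed.

(** The p_i, the u_i and the constants span the linear forms, and constants are fixed; eighteen
    images remain to be compared. *)
Lemma symplectic_ext (F G : lform R -> lform R) : symplectic F -> symplectic G ->
  (forall i, F (pf R i) = G (pf R i)) -> (forall i, F (uf R i) = G (uf R i)) -> F = G.
Proof.
move=> SF SG hp hu; apply/funext => L; rewrite (lform_sum L).
rewrite 2!(symplecticD SF) 2!(symplecticD SG) (symplectic_cst SF) (symplectic_cst SG).
have sum_ext (Q : 'I_9 -> lform R) : (forall j, F (Q j) = G (Q j)) ->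
    F (\sum_j Q j) = G (\sum_j Q j).
  move=> h; elim/big_rec: _ => [|j x _ IH]; first by rewrite !symplectic0.
  by rewrite (symplecticD SF) (symplecticD SG) h IH.
apply: (congr1 (+%R^~ _)); apply: congr2; apply: sum_ext => j.
  by rewrite (symplecticMz SF) (symplecticMz SG) hp.
by rewrite (symplecticMz SF) (symplecticMz SG) hu.
Qed.

End Membership.

(** * Computation on coordinates *)

(* A linear form with integer coordinates, given by the lists of its
   coefficients on the p_i, on the u_i and on the lam_i / 2; on closed lists all
   the operations below are evaluated by computation. *)
Definition coords := (seq int * seq int * seq int)%type.

(** Positions count from 0, so 2, 5, 8 are the indices 3, 6, 9. *)
Definition wt_nat (i : nat) : int := if i \in [:: 2; 5; 8]%N then 2 else 1.

Definition cadd (D E : coords) : coords :=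
  (mkseq (fun t => D.1.1`_t + E.1.1`_t) 9, mkseq (fun t => D.1.2`_t + E.1.2`_t) 9,
   mkseq (fun t => D.2`_t + E.2`_t) 9).

Definition cscale (z : int) (D : coords) : coords :=
  (mkseq (fun t => z * D.1.1`_t) 9, mkseq (fun t => z * D.1.2`_t) 9,
   mkseq (fun t => z * D.2`_t) 9).

Definition cunit (k : nat) : seq int := mkseq (fun t => ((t == k) : nat)%:Z) 9.

(** An empty list is a zero row, by the default value of [nth]. *)
Definition czero : coords := ([::], [::], [::]).
Definition cp (k : nat) : coords := (cunit k, [::], [::]).
Definition cu (k : nat) : coords := ([::], cunit k, [::]).
Definition cl (k : nat) : coords := ([::], [::], mkseq (fun t => 2 * (cunit k)`_t) 9).

Definition comega (D E : coords) : int :=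
  foldr (fun t x => wt_nat t * (D.1.1`_t * E.1.2`_t - D.1.2`_t * E.1.1`_t) + x) 0 (iota 0 9).

Definition cdiff (j k : nat) : seq int := mkseq (fun t => (cunit k)`_t - (cunit j)`_t) 9.

Definition cexp_pu (i j k : nat) (D : coords) : coords :=
  let V := ([::], cdiff j k, [::]) in
  cadd (cadd D (cscale (comega (cp i) D) V)) (cscale (comega V D) (cp i)).

Definition cexp_u (j k : nat) (b : seq int) (D : coords) : coords :=
  cadd D (cscale (comega ([::], b, [::]) D) ([::], [::], cdiff k j)).

Definition cswap (j k t : nat) : nat := if t == j then k else if t == k then j else t.

Lemma cswapE (j k t : 'I_9) : tperm j k t = cswap j k t :> nat.
Proof.
rewrite /cswap; case: tpermP => [->|->|tj tk]; rewrite ?eqxx //; first by case: eqP.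
by case: eqP => [/val_inj //|_]; case: eqP => [/val_inj|].
Qed.

Definition cperm (j k : nat) (D : coords) : coords :=
  (mkseq (fun t => D.1.1`_(cswap j k t)) 9, mkseq (fun t => D.1.2`_(cswap j k t)) 9, D.2).

(** In [cexp_u] the scalar is (lambda_j - lambda_k) / 2, which serves both kinds of operator; hence
    the factor 2 in the list. *)
Definition cP (i j k : nat) (D : coords) : coords :=
  cperm j k (cexp_pu i j k (cexp_u j k (mkseq (fun t => 2 * (cdiff i k)`_t) 9) D)).

Definition cPK (i j k l : nat) (D : coords) : coords :=
  cperm j l (cexp_pu i j l
    (cexp_u j l (mkseq (fun t => 2 * (cdiff i k)`_t + (cdiff j l)`_t) 9) D)).

Section Coords.
Variables (R : realType) (lam : 'I_9 -> R[i]).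

Definition of_coords (D : coords) : lform R :=
  (\row_j D.1.1`_j, \row_j D.1.2`_j, \sum_(j < 9) (D.2`_j)%:~R / 2 * lam j).

Lemma lform_eq (p p' u u' : 'rV[int]_9) (x x' : R[i]) :
  p =1 p' -> u =1 u' -> x = x' -> (p, u, x) = (p', u', x') :> lform R.
Proof.
by move=> hp hu ->; do 2!congr pair; apply/matrixP => i j; rewrite ?hp ?hu.
Qed.

Lemma of_coords0 : of_coords czero = 0.
Proof.
apply: lform_eq => [i|i|]; try by apply/funext => t; rewrite !mxE nth_nil.
by rewrite big1 // => t _; rewrite nth_nil !mul0r.
Qed.

Lemma of_coordsD D E : of_coords (cadd D E) = of_coords D + of_coords E.
Proof.
apply: lform_eq => [i|i|]; try by apply/funext => j; rewrite !mxE nth_mkseq.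
rewrite -big_split; apply: eq_bigr => j _ /=.
by rewrite nth_mkseq // intrD !mulrDl.
Qed.

Lemma of_coordsZ z D : of_coords (cscale z D) = of_coords D *~ z.
Proof.
have -> : of_coords D *~ z = ((of_coords D).1.1 *~ z, (of_coords D).1.2 *~ z, (of_coords D).2 *~ z).
  rewrite [LHS]surjective_pairing [(_ *~ z).1]surjective_pairing.
  by rewrite (raddfMz snd) (raddfMz fst) (raddfMz snd) (raddfMz fst).
have sc (v : 'rV[int]_9) r j : (v *~ z) r j = z * v r j.
  by rewrite -scaler_int intz mxE.
apply: lform_eq => [i|i|]; try by apply/funext => j; rewrite sc !mxE nth_mkseq.
rewrite -mulrzl mulr_sumr; apply: eq_bigr => j _ /=.
by rewrite nth_mkseq // intrM -!mulrA.
Qed.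

Lemma of_coords_p (k : 'I_9) : of_coords (cp k) = pf R k.
Proof.
apply: lform_eq => [i|i|].
- apply/funext => j; rewrite !mxE nth_mkseq // (ord1 i) eqxx -val_eqE /=.
  by case: eqP.
- by apply/funext => j; rewrite !mxE nth_nil.
by rewrite big1 // => j _; rewrite nth_nil !mul0r.
Qed.

Lemma of_coords_u (k : 'I_9) : of_coords (cu k) = uf R k.
Proof.
apply: lform_eq => [i|i|].
- by apply/funext => j; rewrite !mxE nth_nil.
- apply/funext => j; rewrite !mxE nth_mkseq // (ord1 i) eqxx -val_eqE /=.
  by case: eqP.
by rewrite big1 // => j _; rewrite nth_nil !mul0r.
Qed.

Lemma of_coords_cdiff_u (j k : 'I_9) :
  of_coords ([::], cdiff j k, [::]) = uform R (delta_mx 0 k - delta_mx 0 j).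
Proof.
apply: lform_eq => [i|i|].
- by apply/funext => t; rewrite !mxE nth_nil.
- apply/funext => t; rewrite !mxE !nth_mkseq // (ord1 i) eqxx -!val_eqE /=.
  by do 2!case: eqP.
by rewrite big1 // => t _; rewrite nth_nil !mul0r.
Qed.

Lemma of_coords_cdiff_l (j k : 'I_9) :
  of_coords ([::], [::], cdiff j k) = Defs.cst ((lam k - lam j) / 2).
Proof.
have h (l : 'I_9) : \sum_(t < 9) ((cunit l)`_t)%:~R * lam t = lam l.
  rewrite (bigD1 l) //= big1 ?addr0 ?nth_mkseq // ?eqxx ?mul1r // => t tl.
  by rewrite nth_mkseq // (negbTE tl : (t == l :> nat) = false) mul0r.
apply: lform_eq => [i|i|]; try by apply/funext => t; rewrite !mxE nth_nil.
rewrite -(h k) -(h j) -sumrB mulr_suml; apply: eq_bigr => t _.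
by rewrite nth_mkseq // intrB; ring.
Qed.

Lemma of_coords_l (k : 'I_9) : of_coords (cl k) = Defs.cst (lam k).
Proof.
apply: lform_eq => [i|i|]; try by apply/funext => j; rewrite !mxE nth_nil.
rewrite /= (bigD1 k) //= big1 ?addr0.
  by rewrite !nth_mkseq // eqxx mulr1 divff ?mul1r.
by move=> t tl; rewrite !nth_mkseq // (negbTE tl : (t == k :> nat) = false) mulr0 !mul0r.
Qed.

Lemma wt_natE (i : 'I_9) : wt i = wt_nat i.
Proof. by case: i; do 9!case=> //. Qed.

Lemma omega_coords D E : omega (of_coords D).1 (of_coords E).1 = comega D E.
Proof.
have -> : comega D E =
    \sum_(0 <= t < 9) wt_nat t * (D.1.1`_t * E.1.2`_t - D.1.2`_t * E.1.1`_t).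
  by rewrite unlock.
rewrite big_mkord.
by apply: eq_bigr => i _; rewrite !mxE wt_natE.
Qed.

Lemma of_coords_exp_pu (i j k : 'I_9) D :
  (exp_pu R i (delta_mx 0 k - delta_mx 0 j)).2 (of_coords D) = of_coords (cexp_pu i j k D).
Proof.
rewrite /cexp_pu 2!of_coordsD 2!of_coordsZ of_coords_p of_coords_cdiff_u.
by rewrite -2!omega_coords of_coords_p of_coords_cdiff_u.
Qed.

Lemma of_coords_exp_u (j k : 'I_9) (b : seq int) D :
  (exp_u (((lam j - lam k) / 2) *: \row_t (b`_t)%:~R)).2 (of_coords D) =
  of_coords (cexp_u j k b D).
Proof.
rewrite /cexp_u of_coordsD of_coordsZ of_coords_cdiff_l -omega_coords.
move: ((lam j - lam k) / 2) => w.
rewrite [LHS]/(of_coords D + Defs.cst _); apply: (congr1 (+%R _)).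
have cstMz x z : Defs.cst x *~ z = Defs.cst (x *~ z) :> lform R.
  by rewrite (morph_mulrz (f := @Defs.cst R)) //; apply: lcstD.
rewrite cstMz; apply: (congr1 (@Defs.cst R)).
have -> : of_coords ([::], b, [::]) = uform R (\row_t b`_t).
  apply: lform_eq => [i|i|]; try by apply/funext => t; rewrite !mxE ?nth_nil.
  by rewrite big1 // => t _; rewrite nth_nil !mul0r.
rewrite (omega_u (\row_t b`_t)) -mulrzr mulrNz raddf_sum mulrN mulr_sumr -sumrN; apply: eq_bigr => t _.
by rewrite /= !mxE omega_uf !mxE /= mulrNz !intrM; ring.
Qed.

Lemma of_coords_perm (j k : 'I_9) D :
  permL (tperm j k) (of_coords D) = of_coords (cperm j k D).
Proof.
by apply: lform_eq => [i|i|//]; apply/funext => t; rewrite !mxE nth_mkseq // tpermV cswapE.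
Qed.

Lemma Ad_P_coords (i j k : 'I_9) D :
  Ad (Pop lam i j k) (of_coords D) = of_coords (cP i j k D).
Proof.
rewrite Ad_P /comp /cP -of_coords_perm -of_coords_exp_pu -of_coords_exp_u.
apply: (congr1 (fun a => permL _ ((exp_pu R i _).2 ((exp_u a).2 _)))).
apply/rowP => t; rewrite !mxE !nth_mkseq // -!val_eqE eqxx /=.
by do 2!case: eqP => _; rewrite /=; field.
Qed.

Lemma Ad_PK_coords (i j k l : 'I_9) D :
  Ad (PKop lam i j k l) (of_coords D) = of_coords (cPK i j k l D).
Proof.
rewrite Ad_PK /comp /cPK -of_coords_perm -of_coords_exp_pu -of_coords_exp_u.
apply: (congr1 (fun a => permL _ ((exp_pu R i _).2 ((exp_u a).2 _)))).
apply/rowP => t; rewrite !mxE !nth_mkseq // -!val_eqE eqxx /=.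
by do 4!case: eqP => _; rewrite /=; field.
Qed.

End Coords.

(** * The exponents of the phi(Y_i) in coordinates *)

Definition csum (s : seq (int * coords)) : coords :=
  foldr (fun x => cadd (cscale x.1 x.2)) czero s.

Definition vtx_p (k : nat) := cp (vtx k).
Definition vtx_u (k : nat) := cu (vtx k).
Definition vtx_l (k : nat) := cl (vtx k).

Definition phi_coords : seq coords :=
  [:: csum [:: (-1, vtx_l 3); (1, vtx_p 3); (-1, vtx_u 3); (- 2, vtx_p 2)];
      csum [:: (1, vtx_l 3); (-1, vtx_l 6); (1, vtx_p 3); (1, vtx_u 3); (1, vtx_p 6); (-1, vtx_u 6); (- 2, vtx_p 5)];
      csum [:: (1, vtx_l 6); (-1, vtx_l 9); (1, vtx_p 6); (1, vtx_u 6); (1, vtx_p 9); (-1, vtx_u 9); (- 2, vtx_p 8)];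
      csum [:: (1, vtx_l 9); (1, vtx_p 9); (1, vtx_u 9)];
      csum [:: (-1, vtx_l 2); (1, vtx_p 2); (-1, vtx_u 2); (-1, vtx_p 1)];
      csum [:: (1, vtx_l 2); (-1, vtx_l 5); (1, vtx_p 2); (1, vtx_u 2); (1, vtx_p 5); (-1, vtx_u 5); (-1, vtx_p 3);
               (-1, vtx_p 4)];
      csum [:: (1, vtx_l 5); (-1, vtx_l 8); (1, vtx_p 5); (1, vtx_u 5); (1, vtx_p 8); (-1, vtx_u 8); (-1, vtx_p 6);
               (-1, vtx_p 7)];
      csum [:: (1, vtx_l 8); (1, vtx_p 8); (1, vtx_u 8); (-1, vtx_p 9)];
      csum [:: (-1, vtx_l 1); (1, vtx_p 1); (-1, vtx_u 1)];
      csum [:: (1, vtx_l 1); (-1, vtx_l 4); (1, vtx_p 1); (1, vtx_u 1); (1, vtx_p 4); (-1, vtx_u 4); (-1, vtx_p 2)];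
      csum [:: (1, vtx_l 4); (-1, vtx_l 7); (1, vtx_p 4); (1, vtx_u 4); (1, vtx_p 7); (-1, vtx_u 7); (-1, vtx_p 5)];
      csum [:: (1, vtx_l 7); (1, vtx_p 7); (1, vtx_u 7); (-1, vtx_p 8)]].

(* A basis dual to the phiY i up to a factor 4, whence their independence: the
   vectors with omega (phiY i) (phi_dual j) = 4 if i = j and 0 otherwise. *)
Definition phi_dual : seq coords :=
  [:: ([:: - 2; - 2; 3], [:: 2; 4; 3], [::]);
      ([:: - 2; - 2; 1], [:: 2; 4; 3], [::]);
      ([:: - 2; - 2; 1; 0; 0; - 2], [:: 2; 4; 3], [::]);
      ([:: - 2; - 2; 1; 0; 0; - 2; 0; 0; - 2], [:: 2; 4; 3], [::]);
      ([:: - 4; 0; 4], [:: 4; 8; 4], [::]);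
      ([:: - 4; - 4; 4], [:: 4; 8; 4], [::]);
      ([:: - 4; - 4; 4; 0; - 4], [:: 4; 8; 4], [::]);
      ([:: - 4; - 4; 4; 0; - 4; 0; 0; - 4], [:: 4; 8; 4], [::]);
      ([:: 0; 0; 2], [:: 4; 4; 2], [::]);
      ([:: - 4; 0; 2], [:: 4; 4; 2], [::]);
      ([:: - 4; 0; 2; - 4], [:: 4; 4; 2], [::]);
      ([:: - 4; 0; 2; - 4; 0; 0; - 4], [:: 4; 4; 2], [::])].

(** Since e^L e^M = e^[L, M] e^M e^L, this says that phi respects the commutation relations of the
    Y_i. *)
Lemma comega_phi (i j : 'I_12) :
  comega (nth czero phi_coords i) (nth czero phi_coords j) = bhat2 i j.
Proof.
by case: i => i hi; case: j => j hj; do 12?[case: i hi => [|i] hi //];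
   do 12?[case: j hj => [|j] hj //]; vm_compute.
Qed.

Lemma comega_dual (i j : 'I_12) :
  comega (nth czero phi_coords i) (nth czero phi_dual j) = if i == j then 4 else 0.
Proof.
by case: i => i hi; case: j => j hj; do 12?[case: i hi => [|i] hi //];
   do 12?[case: j hj => [|j] hj //]; vm_compute.
Qed.

Lemma bhat2C (i j : 'I_12) : bhat2 j i = - bhat2 i j.
Proof.
by case: i => i hi; case: j => j hj; do 12?[case: i hi => [|i] hi //];
   do 12?[case: j hj => [|j] hj //]; vm_compute.
Qed.

Section Phi.
Variables (R : realType) (lam : 'I_9 -> R[i]).

Lemma of_coords_eqD D E x y : x = of_coords lam D -> y = of_coords lam E ->
  x + y = of_coords lam (cadd D E).
Proof. by move=> -> ->; rewrite of_coordsD. Qed.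

Lemma of_coords_eqN D x : x = of_coords lam D -> - x = of_coords lam (cscale (-1) D).
Proof. by move=> ->; rewrite of_coordsZ mulrN1z. Qed.

Lemma of_coords_eqMn D x n : x = of_coords lam D -> x *+ n = of_coords lam (cscale n D).
Proof. by move=> ->; rewrite of_coordsZ. Qed.

Lemma phiY_coords i : phiY lam i = of_coords lam (nth czero phi_coords i).
Proof.
case: i => i hi; do 12?[case: i hi => [|i] hi //];
(apply: etrans; [rewrite /phiY /nth /=;
  repeat first [apply: of_coords_eqD | apply: of_coords_eqN | apply: of_coords_eqMn
   | exact: esym (of_coords_p _ _) | exact: esym (of_coords_u _ _)
   | exact: esym (of_coords_l _ _)] | by apply: (congr1 (of_coords lam)); vm_compute]).
Qed.

(** The exponent of a Weyl-ordered monomial; unlike [phi_mon] it is additive in [v]. *)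
Definition Lin (v : expo) : lform R := \sum_(i < 12) phiY lam i *+ v i.

Definition expo_seq (s : seq nat) : expo := [ffun i : 'I_12 => nth 0%N s i].

Definition clin (s : seq nat) : coords :=
  foldr (fun i => cadd (cscale (nth 0%N s i)%:Z (nth czero phi_coords i))) czero (iota 0 12).

Lemma Lin_coords s : Lin (expo_seq s) = of_coords lam (clin s).
Proof.
rewrite /Lin /clin.
transitivity (\sum_(0 <= i < 12) of_coords lam (nth czero phi_coords i) *+ nth 0%N s i).
  by rewrite big_mkord; apply: eq_bigr => i _; rewrite ffunE phiY_coords.
rewrite /index_iota subn0; elim: (iota 0 12) => [|i r IH]; first by rewrite big_nil /= of_coords0.
by rewrite big_cons IH /= of_coordsD of_coordsZ.
Qed.

Lemma omega_phiY i j : omega (phiY lam i).1 (phiY lam j).1 = bhat2 i j.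
Proof. by rewrite !phiY_coords omega_coords comega_phi. Qed.

Lemma Lin1 v : (Lin v).1 = \sum_(i < 12) (phiY lam i).1 *+ v i.
Proof. by rewrite /Lin; elim/big_rec2: _ => // i x y _ <-; rewrite lform1D lform1Mn. Qed.

Lemma Lin_inj v w : (Lin v).1 = (Lin w).1 -> v = w.
Proof.
move=> h; apply/ffunP => j.
have dual u : omega (Lin u).1 (of_coords lam (nth czero phi_dual j)).1 = 4 *+ u j.
  rewrite Lin1 omega_suml (bigD1 j) //= big1 => [|i ij].
    by rewrite omegaMnl phiY_coords omega_coords comega_dual eqxx addr0.
  by rewrite omegaMnl phiY_coords omega_coords comega_dual (negbTE ij) mul0rn.
have := etrans (esym (dual v)) (etrans (congr1 (omega^~ _) h) (dual w)).
rewrite -[4 *+ v j]mulr_natr -[4 *+ w j]mulr_natr !natz => /(mulfI _) e.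
by apply/eqP; rewrite -eqz_nat; apply/eqP/e.
Qed.

End Phi.

(** * The embedding of series *)

(** Puts (i, j) and (j, i) together, so that skew symmetry can act. *)
Lemma sum_triangle (V : nmodType) n (f : 'I_n -> 'I_n -> V) :
  \sum_(i < n) \sum_(j < n) f i j =
  \sum_(i < n) f i i + \sum_(i < n) \sum_(j < n | (j < i)%N) (f i j + f j i).
Proof.
transitivity (\sum_(i < n) (\sum_(j < n | (j < i)%N) f i j + f i i + \sum_(j < n | (i < j)%N) f i j)).
  apply: eq_bigr => i _; rewrite (bigID (fun j : 'I_n => (j < i)%N)) /= -addrA.
  congr (_ + _); rewrite (bigD1 i) ?ltnn //=; congr (_ + _); apply: eq_bigl => j.
  by rewrite -leqNgt ltn_neqAle andbC eq_sym -val_eqE.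
rewrite !big_split /= [X in X + _]addrC -addrA; congr (_ + _).
rewrite [X in _ + X](exchange_big_dep xpredT) //= -big_split /=.
by apply: eq_bigr => i _; rewrite big_split.
Qed.

(** The price of normal ordering: [phi_mon v] is [Lin v] plus hbar / 2 times this integer. *)
Definition gam (v : expo) : int :=
  \sum_(i < 12) \sum_(j < 12 | (j < i)%N) bhat2 j i * (v j)%:Z * (v i)%:Z.

Definition bform (k l : expo) : int :=
  \sum_(i < 12) \sum_(j < 12) bhat2 i j * (k i)%:Z * (l j)%:Z.

(** The cocycles of normal and of Weyl ordering, [twist] and half of [bform], differ by the
    coboundary of half of [gam]. *)
Lemma gamD k l : gam k + gam l + bform k l = twist k l *+ 2 + gam (eadd k l).
Proof.
rewrite /bform sum_triangle [X in _ + (X + _)]big1 ?add0r; last first.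
  move=> i _; have := bhat2C i i; lia.
rewrite /gam /twist -sumrMnl -!big_split; apply: eq_bigr => i _ /=.
rewrite -sumrMnl -!big_split; apply: eq_bigr => j _ /=.
by rewrite !ffunE !PoszD (bhat2C i j); ring.
Qed.

Lemma bform_mulr k n : bform k (emul n k) = 0.
Proof.
rewrite /bform sum_triangle big1 ?add0r => [|i _]; last first.
  have := bhat2C i i; lia.
apply: big1 => i _; apply: big1 => j _; rewrite !ffunE !PoszM (bhat2C i j); ring.
Qed.

Section PhiHat.
Variables (R : realType) (hbar : R[i]) (lam : 'I_9 -> R[i]).
Let q := expC hbar.

(** All commutators are constants, so each pair j < i contributes exactly one term hbar / 2 times
    [omega]. *)
Lemma bch_bigop n (F : 'I_n -> lform R) :
  \big[bch hbar/0]_(i < n) F i = \sum_i F i +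
  Defs.cst (hbar / 2 * (\sum_(i < n) \sum_(j < n | (j < i)%N) omega (F j).1 (F i).1)%:~R).
Proof.
elim: n F => [|n IH] F; first by rewrite !big_ord0 mulr0 addr0.
rewrite !big_ord_recl IH [X in _ = _ + Defs.cst (_ * (X + _)%:~R)]big1 ?add0r //.
have -> : \sum_(i < n) \sum_(j < n.+1 | (j < lift ord0 i)%N) omega (F j).1 (F (lift ord0 i)).1 =
   omega (F ord0).1 (\sum_(i < n) F (lift ord0 i)).1 + \sum_(i < n) \sum_(j < n | (j < i)%N)
     omega (F (lift ord0 j)).1 (F (lift ord0 i)).1.
  have -> : (\sum_(i < n) F (lift ord0 i)).1 = \sum_(i < n) (F (lift ord0 i)).1.
    by elim/big_rec2: _ => // i x y _ <-.
  rewrite omega_sumr -big_split; apply: eq_bigr => i _ /=.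
  by rewrite big_mkcond big_ord_recl /= [in RHS]big_mkcond.
rewrite /bch intrD mulrDr lcstD -!addrA; do 2!apply: (congr1 (+%R _)).
rewrite addrC; apply: (congr1 (+%R^~ _)).
by rewrite lform1D addr0.
Qed.

Lemma phi_monE v : phi_mon hbar lam v = Lin lam v + Defs.cst (hbar / 2 * (gam v)%:~R).
Proof.
rewrite /phi_mon bch_bigop; congr (_ + Defs.cst (_ * _%:~R)).
apply: eq_bigr => i _; apply: eq_bigr => j _.
rewrite !lform1Mn omegaMnl omegaMnr omega_phiY -!mulrnA.
by rewrite -mulr_natr natrM !natz; ring.
Qed.

Lemma phi_mon1 v : (phi_mon hbar lam v).1 = (Lin lam v).1.
Proof. by rewrite phi_monE lform1D addr0. Qed.

Lemma phi_mon2 v : (phi_mon hbar lam v).2 = (Lin lam v).2 + hbar / 2 * (gam v)%:~R.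
Proof. by rewrite phi_monE. Qed.

Lemma omega_Lin k l : omega (Lin lam k).1 (Lin lam l).1 = bform k l.
Proof.
rewrite /bform !Lin1 omega_suml; apply: eq_bigr => i _; rewrite omega_sumr; apply: eq_bigr => j _.
rewrite omegaMnl omegaMnr omega_phiY -!mulrnA -mulr_natr natrM !natz; ring.
Qed.

Lemma LinD k l : Lin lam (eadd k l) = Lin lam k + Lin lam l.
Proof.
rewrite /Lin -big_split; apply: eq_bigr => i _ /=.
by rewrite ffunE mulrnDr.
Qed.

Lemma Lin_mul n k : Lin lam (emul n k) = Lin lam k *+ n.
Proof.
rewrite /Lin -sumrMnl; apply: eq_bigr => i _ /=.
by rewrite ffunE mulnC mulrnA.
Qed.

Lemma phi_mon_mul k l :
  expC (phi_mon hbar lam k).2 * expC (phi_mon hbar lam l).2 *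
    expC (bch hbar ((Lin lam k).1, 0) ((Lin lam l).1, 0)).2 =
  q ^ twist k l * expC (phi_mon hbar lam (eadd k l)).2.
Proof.
have LD : (Lin lam (eadd k l)).2 = (Lin lam k).2 + (Lin lam l).2 by rewrite LinD.
have bE : (bch hbar ((Lin lam k).1, 0) ((Lin lam l).1, 0)).2 =
    hbar / 2 * (bform k l)%:~R.
  by rewrite -[LHS]/(0 + 0 + _) !add0r -omega_Lin.
have gE : gam (eadd k l) =
    gam k + gam l + bform k l - twist k l * 2.
  by rewrite gamD mulr_natr addrC addKr.
rewrite -expCMz -!expCD !phi_mon2 LD bE gE -[hbar *~ _]mulrzr intrD intrN !intrD intrM.
move: (gam k)%:~R (gam l)%:~R (bform k l)%:~R (twist k l)%:~R (Lin lam k).2 (Lin lam l).2.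
by move=> x y z t a b; congr expC; rewrite -[(2 : int)%:~R]/(2 : R[i]); field.
Qed.

Section Sets.
Local Open Scope classical_set_scope.

Lemma phi_hat_in (a : Aseries R) n :
  phi_hat hbar lam a (Lin lam n).1 = a n * expC (phi_mon hbar lam n).2.
Proof.
rewrite /phi_hat (_ : [set _ | _] = [set n]) ?fsbig_set1 //.
apply/seteqP; split=> k /=; rewrite phi_mon1; last by move->.
exact: Lin_inj.
Qed.

Lemma phi_hat_out (a : Aseries R) m : (forall n, (Lin lam n).1 <> m) ->
  phi_hat hbar lam a m = 0.
Proof.
move=> h; rewrite /phi_hat (_ : [set _ | _] = set0) ?fsbig_set0 //.
by apply/seteqP; split=> k //=; rewrite phi_mon1 => /h.
Qed.

Lemma phi_hat_neq0 (a : Aseries R) m : phi_hat hbar lam a m != 0 -> exists n, (Lin lam n).1 = m.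
Proof.
move=> h; apply: contrapT => hn; case/eqP: h; apply: phi_hat_out => n e.
by apply: hn; exists n.
Qed.

(** Images of series are supported on the points [(Lin n).1], each coming from a single exponent by
    [Lin_inj]. The sum over all pairs of lattice points therefore shrinks to pairs of exponents. *)
Lemma phi_hatM (a b : Aseries R) :
  phi_hat hbar lam (Amul hbar a b) = Fmul hbar (phi_hat hbar lam a) (phi_hat hbar lam b).
Proof.
apply/funext => m; rewrite /Fmul.
pose h (kl : expo * expo) : lat * lat := ((Lin lam kl.1).1, (Lin lam kl.2).1).
pose S := [set kl : expo * expo | (Lin lam (eadd kl.1 kl.2)).1 = m].
rewrite -(fsbig_widen (h @` S)); last 2 first.
- by move=> _ [[k l] /= <- <-] /=; rewrite LinD.
- move=> [x y] [xy nS]; suff e0 : phi_hat hbar lam a x * phi_hat hbar lam b y = 0.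
    by rewrite /preimage /mkset /fst /snd e0 mul0r.
  have [/phi_hat_neq0 [k kx]|] := boolP (phi_hat hbar lam a x != 0); last first.
    by rewrite negbK => /eqP ->; rewrite mul0r.
  have [/phi_hat_neq0 [l ly]|] := boolP (phi_hat hbar lam b y != 0); last first.
    by rewrite negbK => /eqP ->; rewrite mulr0.
  case: nS; exists (k, l); last by rewrite /h kx ly.
  by rewrite /S /mkset LinD lform1D kx ly.
rewrite fsbig_image; last first.
  by move=> [k l] [k' l'] _ _ [/Lin_inj -> /Lin_inj ->].
have [[n nm]|nm] := pselect (exists n, (Lin lam n).1 = m).
  rewrite -nm phi_hat_in /Amul mulr_fsuml.
  have -> : [set kl : expo * expo | forall i, (kl.1 i + kl.2 i)%N = n i] = S.
    apply/seteqP; split=> [[k l] /= e|[k l]]; rewrite /S -nm /mkset.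
      by congr ((Lin lam _).1); apply/ffunP => i; rewrite ffunE e.
    by move=> /Lin_inj <- i; rewrite ffunE.
  apply: eq_fsbigr => [[k l]]; rewrite inE /S /mkset -nm => /Lin_inj <-.
  rewrite /h /fst /snd !phi_hat_in -/(twist k l) -/q -[LHS]mulrA -phi_mon_mul.
  move: (expC _) (expC _) (expC _) => x y z.
  by rewrite -!mulrA; congr (_ * _); rewrite mulrCA.
rewrite phi_hat_out; last by move=> n e; apply: nm; exists n.
rewrite (_ : S = set0) ?fsbig_set0 //.
by apply/seteqP; split=> // kl /= e; apply: nm; exists (eadd kl.1 kl.2).
Qed.

End Sets.
End PhiHat.

(** * The adjoint action on formal series *)

Section Transport.
Local Open Scope classical_set_scope.
Variables (R : realType) (hbar : R[i]) (w : NSelt R).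
Hypothesis symw : symplectic (Ad w).

Let A (n : lat) : lat := (Ad w (n, 0)).1.

Lemma Ad1 L : (Ad w L).1 = A L.1.
Proof.
by rewrite {1}(lform_split L) (symplecticD symw) (symplectic_cst symw) lform1D addr0.
Qed.

Lemma Ad2 L : (Ad w L).2 = (Ad w (L.1, 0)).2 + L.2.
Proof. by rewrite {1}(lform_split L) (symplecticD symw) (symplectic_cst symw). Qed.

Lemma Ad_latD a b : A (a + b) = A a + A b.
Proof.
by rewrite -[A a + A b]lform1D -(symplecticD symw) Ad1.
Qed.

(** The inverse map also commutes with adding constants, so it descends to the lattice parts. *)
Lemma Ad_lat_bij : bijective A.
Proof.
case: (symw) => _ Fc _ [G [FK GK]].
have Gc L x : G (L + Defs.cst x) = G L + Defs.cst x.
  by apply: (can_inj FK); rewrite GK (symplecticD symw) Fc GK.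
exists (fun m => (G (m, 0)).1) => n.
  have -> : ((A n, 0) : lform R) = Ad w (n, 0) + Defs.cst (- (Ad w (n, 0)).2).
    rewrite {1}(lform_split (Ad w (n, 0))) -addrA -lcstD subrr.
    by rewrite -[Defs.cst 0]/(0 : lform R) addr0.
  by rewrite Gc FK lform1D addr0.
rewrite /A; have -> : (((G (n, 0)).1, 0) : lform R) = G (n, 0) + Defs.cst (- (G (n, 0)).2).
  rewrite {2}(lform_split (G (n, 0))) -addrA -lcstD subrr.
  by rewrite -[Defs.cst 0]/(0 : lform R) addr0.
by rewrite (symplecticD symw) (symplectic_cst symw) GK lform1D addr0.
Qed.

Let A_inj : injective A. Proof. exact: bij_inj Ad_lat_bij. Qed.

Lemma AdF_at (f : fseries R) n : AdF w f (A n) = f n * expC (Ad w (n, 0)).2.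
Proof.
rewrite /AdF (_ : [set _ | _] = [set n]) ?fsbig_set1 //.
by apply/seteqP; split=> [k /A_inj //|k ->].
Qed.

Lemma AdF_ext (f g : fseries R) : (forall n, f (A n) = g (A n)) -> f = g.
Proof.
by case: Ad_lat_bij => B _ BK h; apply/funext => m; rewrite -(BK m).
Qed.

(** The phase of [Ad w] is additive in the exponent, and the BCH phase depends only on [omega],
    which [Ad w] preserves. *)
Lemma AdF_mul (f g : fseries R) :
  AdF w (Fmul hbar f g) = Fmul hbar (AdF w f) (AdF w g).
Proof.
apply: AdF_ext => n; rewrite AdF_at /Fmul mulr_fsuml.
pose h (ab : lat * lat) := (A ab.1, A ab.2).
rewrite [RHS](reindex_fsbig h [set ab : lat * lat | ab.1 + ab.2 = n]); last first.
  split.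
  - by move=> [a b] <-; rewrite /mkset /h Ad_latD.
  - by move=> [a b] [a' b'] _ _ [/A_inj -> /A_inj ->].
  case: Ad_lat_bij => B BA AB [a b]; rewrite /mkset /fst /snd => e.
  exists (B a, B b); last by rewrite /h !AB.
  by apply: A_inj; rewrite Ad_latD !AB.
apply: eq_fsbigr => [[a b]]; rewrite inE /mkset => abn.
have e1 : AdF w f (h (a, b)).1 = f a * expC (Ad w (a, 0)).2 := AdF_at f a.
have e2 : AdF w g (h (a, b)).2 = g b * expC (Ad w (b, 0)).2 := AdF_at g b.
have e3 : (bch hbar ((h (a, b)).1, 0) ((h (a, b)).2, 0)).2 = (bch hbar (a, 0) (b, 0)).2.
  by rewrite /bch /h (symplectic_omega symw (a, 0) (b, 0)).
rewrite e1 e2 e3 {e1 e2 e3}.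
have -> : (bch hbar ((a, b).1, 0) ((a, b).2, 0)).2 = (bch hbar (a, 0) (b, 0)).2 by [].
have -> : f (a, b).1 * g (a, b).2 = f a * g b by [].
have -> : expC (Ad w (n, 0)).2 = expC (Ad w (a, 0)).2 * expC (Ad w (b, 0)).2.
  rewrite -expCD -abn; congr expC.
  have -> : ((a + b, 0) : lform R) = (a, 0) + (b, 0).
    by rewrite -[RHS]/(a + b, 0 + 0) addr0.
  by rewrite (symplecticD symw).
by move: (f a) (g b) (expC _) (expC _) (expC _) => s t x y z; ring.
Qed.

Lemma AdF_subst c L : AdF w (subst_exp c L) = subst_exp c (Ad w L).
Proof.
apply: AdF_ext => n; rewrite AdF_at /subst_exp mulr_fsuml.
have -> : [set k : nat | (Ad w L *+ k).1 = A n] = [set k : nat | (L *+ k).1 = n].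
  apply/seteqP; split=> k; rewrite /mkset -(symplecticMn symw) Ad1; first exact: A_inj.
  by move->.
apply: eq_fsbigr => k; rewrite inE /mkset => <-.
by rewrite -(symplecticMn symw) [in RHS]Ad2 expCD -mulrA [X in _ * X]mulrC.
Qed.

End Transport.

(** * Series of one monomial *)

Lemma convC (K : comPzRingType) (c c' : nat -> K) n : conv c c' n = conv c' c n.
Proof.
rewrite /conv (reindex_inj rev_ord_inj); apply: eq_bigr => i _ /=.
have h : (i <= n)%N by rewrite -ltnS.
by rewrite subSS (subKn h) mulrC.
Qed.

Definition pinv (R : realType) (c : nat -> R[i]) (n : nat) : R[i] := (inv_coefs c n)`_n.

Section InverseSeries.
Variables (R : realType) (c : nat -> R[i]).
Hypothesis c0 : c 0%N = 1.

Lemma size_inv_coefs n : size (inv_coefs c n) = n.+1.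
Proof. by elim: n => //= n IH; rewrite size_rcons IH. Qed.

Lemma nth_inv_coefs n k : (k <= n)%N -> (inv_coefs c n)`_k = pinv c k.
Proof.
elim: n => [|n IH]; first by rewrite leqn0 => /eqP ->.
rewrite leq_eqVlt => /predU1P[-> //|kn].
by rewrite /= nth_rcons size_inv_coefs kn IH.
Qed.

Lemma pinvS n : pinv c n.+1 = - \sum_(k < n.+1) c (n.+1 - k)%N * pinv c k.
Proof.
rewrite {1}/pinv /= nth_rcons size_inv_coefs ltnn eqxx; congr (- _).
by apply: eq_bigr => k _; rewrite nth_inv_coefs // -ltnS.
Qed.

Lemma conv_pinv n : conv c (pinv c) n = one_coef _ n.
Proof.
case: n => [|n]; first by rewrite /conv big_ord1 c0 mulr1.
rewrite convC /conv big_ord_recr /= subnn c0 mulr1 pinvS.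
by rewrite -sumrB big1 // => i _; rewrite mulrC subrr.
Qed.

End InverseSeries.

(** * Coefficients in Q(q) *)

Section Rationality.
Variables (R : realType) (hbar : R[i]).
Let q := expC hbar.

Definition evalq (f : {poly rat}) : R[i] := (map_poly ratr f).[q].

Lemma evalqM f g : evalq (f * g) = evalq f * evalq g.
Proof. by rewrite /evalq (rmorphM (map_poly _)) hornerM. Qed.

Lemma evalqD f g : evalq (f + g) = evalq f + evalq g.
Proof. by rewrite /evalq (rmorphD (map_poly _)) hornerD. Qed.

Lemma evalqN f : evalq (- f) = - evalq f.
Proof. by rewrite /evalq (rmorphN (map_poly _)) hornerN. Qed.

Lemma evalq0 : evalq 0 = 0.
Proof. by rewrite /evalq (rmorph0 (map_poly _)) horner0. Qed.

Lemma evalq1 : evalq 1 = 1.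
Proof. by rewrite /evalq (rmorph1 (map_poly _)) hornerC. Qed.

Lemma evalqX : evalq 'X = q.
Proof. by rewrite /evalq map_polyX hornerX. Qed.

Lemma inQqP x :
  inQq hbar x <-> exists f g, evalq g != 0 /\ x = evalq f / evalq g.
Proof. by []. Qed.

Lemma inQq_div x y : inQq hbar x -> inQq hbar y -> y != 0 -> inQq hbar (x / y).
Proof.
move=> /inQqP[f1 [g1 [g1n ->]]] /inQqP[f2 [g2 [g2n ->]]] h.
have f2n : evalq f2 != 0 by apply: contraNneq h => ->; rewrite mul0r.
apply/inQqP; exists (f1 * g2), (g1 * f2); rewrite !evalqM mulf_neq0 //; split=> //.
by rewrite invf_div mulf_div.
Qed.

Lemma inQqD x y : inQq hbar x -> inQq hbar y -> inQq hbar (x + y).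
Proof.
move=> /inQqP[f1 [g1 [g1n ->]]] /inQqP[f2 [g2 [g2n ->]]].
apply/inQqP; exists (f1 * g2 + f2 * g1), (g1 * g2).
by rewrite evalqD !evalqM mulf_neq0 //; split=> //; rewrite addf_div.
Qed.

Lemma inQq_evalq f : inQq hbar (evalq f).
Proof. by apply/inQqP; exists f, 1; rewrite evalq1 oner_neq0 divr1. Qed.

Lemma inQq1 : inQq hbar 1.
Proof. by rewrite -evalq1; apply: inQq_evalq. Qed.

Lemma inQq0 : inQq hbar 0.
Proof. by rewrite -evalq0; apply: inQq_evalq. Qed.

Lemma inQqq : inQq hbar q.
Proof. by rewrite -evalqX; apply: inQq_evalq. Qed.

Lemma inQqN x : inQq hbar x -> inQq hbar (- x).
Proof.
move=> /inQqP[f [g [gn ->]]]; apply/inQqP; exists (- f), g; split=> //.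
by rewrite evalqN mulNr.
Qed.

Lemma inQqM x y : inQq hbar x -> inQq hbar y -> inQq hbar (x * y).
Proof.
move=> /inQqP[f1 [g1 [g1n ->]]] /inQqP[f2 [g2 [g2n ->]]].
apply/inQqP; exists (f1 * f2), (g1 * g2); rewrite !evalqM mulf_neq0 //; split=> //.
by rewrite mulf_div.
Qed.

Lemma inQq_exp x n : inQq hbar x -> inQq hbar (x ^+ n).
Proof.
move=> hx; elim: n => [|n IH]; first by rewrite expr0; apply: inQq1.
by rewrite exprS; apply: inQqM.
Qed.

Lemma inQq_q_exprz (z : int) : inQq hbar (q ^ z).
Proof.
case: z => n; first exact/inQq_exp/inQqq.
rewrite NegzE -exprnN -[_^-1]mul1r; apply: inQq_div; first exact: inQq1.
  exact/inQq_exp/inQqq.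
by rewrite expf_neq0 // expC_neq0.
Qed.

Lemma inQq_sum (J : Type) (r : seq J) (P : pred J) F :
  (forall j, inQq hbar (F j)) -> inQq hbar (\sum_(j <- r | P j) F j).
Proof.
by move=> h; apply: big_ind => //; [exact: inQq0 | exact: inQqD].
Qed.

Lemma inQq_prod (J : Type) (r : seq J) (P : pred J) F :
  (forall j, inQq hbar (F j)) -> inQq hbar (\prod_(j <- r | P j) F j).
Proof.
by move=> h; apply: big_ind => //; [exact: inQq1 | exact: inQqM].
Qed.

Lemma inA_mul (a b : Aseries R) : inA hbar a -> inA hbar b -> inA hbar (Amul hbar a b).
Proof.
move=> ha hb n; apply: inQq_sum => kl; apply: inQqM; last exact: inQq_q_exprz.
exact: inQqM.
Qed.

Hypothesis q_generic : forall n : nat, (0 < n)%N -> q ^+ n != 1.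

Lemma qpoch_neq0 d n : (0 < d)%N ->
  qpoch ((q ^+ d) ^+ 2) ((q ^+ d) ^+ 2) n != 0.
Proof.
move=> d0; apply/prodf_neq0 => k _; rewrite -exprS -!exprM subr_eq0 eq_sym.
by apply: q_generic; rewrite !muln_gt0 d0.
Qed.

Lemma psi_coef_Qq d n : (0 < d)%N -> inQq hbar (psi_coef (q ^+ d) n).
Proof.
move=> d0; apply: inQq_div; last exact: qpoch_neq0.
  exact/inQq_exp/inQqN/inQq_exp/inQqq.
apply: inQq_prod => k; apply: inQqD; first exact: inQq1.
by apply/inQqN/inQqM; do ?apply: inQq_exp; apply: inQqq.
Qed.

Lemma pinv_Qq c n : (forall n, inQq hbar (c n)) -> inQq hbar (pinv c n).
Proof.
move=> hc; elim/ltn_ind: n => [[|n] IH]; first exact: inQq1.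
rewrite pinvS; apply: inQqN; apply: big_ind; [exact: inQq0|exact: inQqD|].
by move=> k _; apply: inQqM => //; apply: IH.
Qed.

Lemma psi_coef_rec d : (0 < d)%N -> psi_rec (q ^+ d) (psi_coef (q ^+ d)).
Proof.
move=> d0; split; first by rewrite /psi_coef /qpoch expr0 big_ord0 divr1.
move=> n; have := qpoch_neq0 n.+1 d0.
rewrite /psi_coef /qpoch big_ord_recr /= -exprS mulf_eq0 negb_or => /andP[h1 h2].
rewrite exprS; move: (\prod_(_ < _) _) (1 - _) h1 h2 => x y h1 h2.
by field; rewrite h1.
Qed.

Lemma q_generic2 d : (0 < d)%N -> forall n, 1 - ((q ^+ d) ^+ 2) ^+ n.+1 != 0.
Proof.
move=> d0 n; rewrite -!exprM subr_eq0 eq_sym; apply: q_generic.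
by rewrite !muln_gt0 d0.
Qed.

End Rationality.

(** * Weyl-ordered monomials and their truncated matrices *)

Section Weyl.
Local Open Scope classical_set_scope.
Variables (R : realType) (hbar : R[i]) (lam : 'I_9 -> R[i]).
Let q := expC hbar.

(** The preimage under [phi_hat] of e^(Lin v): the phase of normal ordering is divided out. *)
Definition weyl (v : expo) : Aseries R :=
  fun n => if n == v then expC (- (hbar / 2 * (gam v)%:~R)) else 0.

(* The preimage under phi_hat of sum_k c_k e^(k L) for the linear form L = Lin v;
   the factor undoes the normal ordering of the Y_i in phi_mon. *)
Definition weyl_series (c : nat -> R[i]) (v : expo) : Aseries R := fun n =>
  (\sum_(k \in [set k : nat | emul k v = n]) c k) * expC (- (hbar / 2 * (gam n)%:~R)).

Lemma phi_hat_weyl_series c v :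
  phi_hat hbar lam (weyl_series c v) = subst_exp c (Lin lam v).
Proof.
apply/funext => m.
have [[n <-]|nm] := pselect (exists n, (Lin lam n).1 = m).
  rewrite phi_hat_in /weyl_series -mulrA -expCD phi_mon2 /subst_exp mulr_fsuml.
  have -> : [set k : nat | emul k v = n] = [set k : nat | (Lin lam v *+ k).1 = (Lin lam n).1].
    apply/seteqP; split=> k; rewrite /mkset -Lin_mul; first by move->.
    exact: Lin_inj.
  apply: eq_fsbigr => k; rewrite inE /mkset -Lin_mul => /Lin_inj ->.
  by rewrite addrC addrK.
rewrite phi_hat_out; last by move=> n e; apply: nm; exists n.
rewrite /subst_exp (_ : [set k : nat | _] = set0) ?fsbig_set0 //.
by apply/seteqP; split=> // k /= e; apply: nm; exists (emul k v); rewrite Lin_mul.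
Qed.

Lemma weyl_mul v w : Amul hbar (weyl v) (weyl w) =
  fun n => expC (hbar / 2 * (bform v w)%:~R) * weyl (eadd v w) n.
Proof.
apply/funext => n; rewrite /Amul.
pose F (kl : expo * expo) := weyl v kl.1 * weyl w kl.2 * q ^ twist kl.1 kl.2.
pose S := [set kl : expo * expo | forall i, (kl.1 i + kl.2 i)%N = n i].
rewrite -/(\sum_(kl \in S) F kl).
have F0 kl : kl != (v, w) -> F kl = 0.
  case: kl => k l; rewrite xpair_eqE negb_and /F /weyl /= => /orP[/negbTE->|/negbTE->].
    by rewrite !mul0r.
  by rewrite mulr0 mul0r.
rewrite [in RHS]/weyl; have [e|nvw] := eqVneq n (eadd v w); last first.
  rewrite mulr0; apply: fsbig1 => -[k l] kl; apply: F0; apply: contra nvw => /eqP e.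
  by apply/eqP/ffunP => i; move: (kl i); rewrite e ffunE.
subst n; rewrite -(fsbig_widen [set (v, w)]); last 2 first.
- by move=> _ -> i; rewrite ffunE.
- by move=> kl [_ /eqP kvw]; rewrite /preimage /= F0.
rewrite fsbig_set1 /F /weyl !eqxx -expCMz -!expCD; congr expC.
have gE : gam (eadd v w) =
    gam v + gam w + bform v w - twist v w * 2.
  by rewrite gamD mulr_natr addrC addKr.
rewrite gE -[hbar *~ _]mulrzr intrD intrN !intrD intrM.
move: (gam v)%:~R (gam w)%:~R (bform v w)%:~R (twist v w)%:~R => x y z t.
by rewrite -[(2 : int)%:~R]/(2 : R[i]); field.
Qed.

Section Truncation.
Variable K : nat.
Local Notation mx := (box_mx hbar K).
Local Notation wmx v := (mx (weyl v)).

Lemma box_mxZ x (a : Aseries R) : mx (fun n => x * a n) = x *: mx a.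
Proof.
by apply/matrixP => i j; rewrite !mxE /box_coef; case: ifP; rewrite ?mulr0 // mulrA.
Qed.

Lemma weyl_mxM v w :
  wmx v * wmx w = expC (hbar / 2 * (bform v w)%:~R) *: wmx (eadd v w).
Proof. by rewrite -box_mxM weyl_mul box_mxZ. Qed.

Lemma gam0 : gam ezero = 0.
Proof. by apply: big1 => i _; apply: big1 => j _; rewrite !ffunE mulr0. Qed.

Lemma weyl0 : weyl ezero = Aone R.
Proof.
apply/funext => n; rewrite /weyl /Aone gam0 mulr0 oppr0 expC0.
have -> : (n == ezero) = [forall i, n i == 0%N].
  apply/eqP/forallP => [-> i|h]; first by rewrite ffunE.
  by apply/ffunP => i; rewrite ffunE; apply/eqP.
by case: ifP.
Qed.

Lemma weyl_mxX v k : wmx v ^+ k = wmx (emul k v).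
Proof.
elim: k => [|k IH].
  have -> : emul 0 v = ezero by apply/ffunP => i; rewrite !ffunE mul0n.
  by rewrite expr0 weyl0 box_mx1.
rewrite exprS IH weyl_mxM bform_mulr mulr0 expC0 scale1r.
by congr (mx (weyl _)); apply/ffunP => i; rewrite !ffunE mulSn.
Qed.

Definition box_deg (b : box_exp K) : nat := \sum_i b i.

(** Such a matrix raises the total degree by at least [r]. Degrees in the box are at most 12 K,
    whence the bound 12 K + 1 for nilpotency. *)
Definition box_filt (r : nat) (M : 'M[R[i]]_((box_dim K).+1)) : Prop :=
  forall i j, (box_deg (box i) < box_deg (box j) + r)%N -> M i j = 0.

Lemma box_deg_le b : (box_deg b <= 12 * K)%N.
Proof.
rewrite -[12%N]card_ord -sum_nat_const; apply: leq_sum => i _.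
by rewrite -ltnS.
Qed.

Lemma box_filtration : nil_filtration (12 * K).+1%N box_filt.
Proof.
split.
- by move=> n x y hx hy i j h; rewrite mxE hx ?hy ?addr0.
- by move=> n k x hx i j h; rewrite mxE hx ?mulr0.
- move=> k m n x y kmn hx hy i j h; rewrite mxE big1 // => l _.
  have [h1|h1] := ltnP (box_deg (box i)) (box_deg (box l) + m).
    by rewrite hx ?mul0r.
  rewrite hy ?mulr0 //; have := leq_ltn_trans h1 (leq_trans h (leq_add (leqnn _) kmn)).
  by rewrite addnC addnCA ltn_add2l.
- by move=> i j; rewrite addn0 mxE; case: eqP => // ->; rewrite ltnn.
move=> n x nK hx; apply/matrixP => i j; rewrite mxE; apply: hx.
apply: leq_ltn_trans (box_deg_le _) _; apply: leq_trans (leq_addl _ _).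
exact: nK.
Qed.

Lemma weyl_filt v : v != ezero -> box_filt 1 (wmx v).
Proof.
move=> v0 i j; rewrite addn1 ltnS mxE /box_coef /weyl.
case: ifP => // /unbox_leP ji; case: eqP => [e|]; last by rewrite mul0r.
rewrite /box_deg => h; case/eqP: v0; apply/ffunP => t; rewrite ffunE -e !ffunE.
apply/eqP; rewrite subn_eq0 leqNgt; apply/negP => lt.
move: h; rewrite leqNgt => /negP[].
rewrite (bigD1 t) //= [ltnRHS](bigD1 t) //= -addSn; apply: leq_add => //.
by apply: leq_sum.
Qed.

(** As v has a nonzero entry, k v stays in the box only for k <= K, so the truncation loses
    nothing. *)
Lemma weyl_series_mx c v : v != ezero ->
  mx (weyl_series c v) = @ev _ _ (12 * K).+1%N c (wmx v).
Proof.
move=> v0; apply/matrixP => i j; rewrite /ev summxE mxE.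
under eq_bigr do rewrite weyl_mxX !mxE.
rewrite /box_coef; case: ifP => [ji|_]; last by rewrite big1 // => k _; rewrite mulr0.
set n := esub _ _; rewrite /weyl_series.
rewrite (fsbig_fintype (P := fun k : 'I_(12 * K).+1 => emul k v == n) (h := val)).
- rewrite !mulr_suml [LHS]big_mkcond.
  apply: eq_bigr => k _; rewrite /weyl eq_sym; case: eqP => [<-|_].
    by rewrite !mulrA.
  by rewrite mul0r mulr0.
- by move=> k /eqP.
- by move=> k l _ _ /val_inj.
move=> k kn; have [t vt] : exists t, v t != 0%N.
  apply/existsP; rewrite -negb_forall; apply: contra v0 => /forallP h.
  by apply/eqP/ffunP => t; rewrite ffunE; apply/eqP.
have nt : (n t <= K)%N.
  by rewrite !ffunE; apply: leq_trans (leq_subr _ _) _; rewrite -ltnS.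
have kK : (k <= K)%N.
  apply: leq_trans nt; move/ffunP: kn => /(_ t) <-.
  by rewrite ffunE leq_pmulr // lt0n.
have kN : (k < (12 * K).+1)%N by rewrite ltnS; apply: leq_trans kK _; rewrite leq_pmull.
by exists (Ordinal kN) => //; apply/eqP.
Qed.

End Truncation.
End Weyl.

Lemma expo_seq_add s t u :
  all (fun i => nth 0 s i + nth 0 t i == nth 0 u i)%N (iota 0 12) ->
  eadd (expo_seq s) (expo_seq t) = expo_seq u.
Proof.
move=> /allP h; apply/ffunP => i; rewrite !ffunE; apply/eqP/h.
by rewrite mem_iota ltn_ord.
Qed.

Lemma expo_seq_neq0 s : has (fun i => nth 0%N s i != 0%N) (iota 0 12) ->
  expo_seq s != ezero.
Proof.
case/hasP => i; rewrite mem_iota => /= hi; apply: contraNneq => /ffunP /(_ (Ordinal hi)).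
by rewrite !ffunE /= => ->.
Qed.

Definition cgam (s : seq nat) : int :=
  foldr (fun i x => foldr (fun j y => comega (nth czero phi_coords j) (nth czero phi_coords i) *
    (nth 0%N s j)%:Z * (nth 0%N s i)%:Z + y) 0 (iota 0 i) + x) 0 (iota 0 12).

Lemma gam_expo_seq s : gam (expo_seq s) = cgam s.
Proof.
pose G j i := comega (nth czero phi_coords j) (nth czero phi_coords i) *
    (nth 0%N s j)%:Z * (nth 0%N s i)%:Z.
transitivity (\sum_(0 <= i < 12) \sum_(0 <= j < i) G j i); last by rewrite !unlock.
rewrite big_mkord; apply: eq_bigr => i _.
rewrite (big_nat_widen 0 i 12) ?(ltnW (ltn_ord i)) // big_mkord.
by apply: eq_bigr => j _; rewrite /G comega_phi !ffunE.
Qed.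

(** * Units of the completed algebra *)

Section SeriesUnits.
Variables (R : realType) (hbar : R[i]).
Let q := expC hbar.
(** Constants do not affect [omega], so commutation exponents may be computed at lambda = 0. *)
Let lam0 : 'I_9 -> R[i] := fun=> 0.

Lemma AmulA (a b c : Aseries R) :
  Amul hbar a (Amul hbar b c) = Amul hbar (Amul hbar a b) c.
Proof. by apply: (@box_mx_inj _ hbar) => K; rewrite !box_mxM mulrA. Qed.

Lemma Amul1 (a : Aseries R) : Amul hbar a (Aone R) = a.
Proof. by apply: (@box_mx_inj _ hbar) => K; rewrite box_mxM box_mx1 mulr1. Qed.

Lemma Aone_mul (a : Aseries R) : Amul hbar (Aone R) a = a.
Proof. by apply: (@box_mx_inj _ hbar) => K; rewrite box_mxM box_mx1 mul1r. Qed.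

Lemma inA_one : inA hbar (Aone R).
Proof. by move=> n; rewrite /Aone; case: forallP => _; [exact: inQq1 | exact: inQq0]. Qed.

Lemma Aunit_one : Aunit hbar (Aone R).
Proof.
by split; [exact: inA_one | exists (Aone R); rewrite Amul1; split=> //; exact: inA_one].
Qed.

Lemma Aunit_mul (a b : Aseries R) : Aunit hbar a -> Aunit hbar b -> Aunit hbar (Amul hbar a b).
Proof.
move=> [ha [a' [ha' aa' a'a]]] [hb [b' [hb' bb' b'b]]]; split; first exact: inA_mul.
exists (Amul hbar b' a'); split; first exact: inA_mul.
  by rewrite -AmulA [Amul _ b _]AmulA bb' Aone_mul.
by rewrite -AmulA [Amul _ a' _]AmulA a'a Aone_mul.
Qed.

(** As gam(k v) = k^2 gam(v), evenness of gam(v) makes the ordering factor of every power of the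
    monomial an integral power of q. *)
Lemma inA_weyl_series c v g : gam v = 2 * g -> (forall n, inQq hbar (c n)) ->
  inA hbar (weyl_series hbar c v).
Proof.
move=> gv hc n; rewrite /weyl_series.
have [[k <-]|nk] := pselect (exists k, emul k v = n).
  apply: inQqM; first exact: inQq_sum.
  have -> : gam (emul k v) = 2 * (g * (k * k)%N%:Z).
    transitivity (gam v * (k * k)%N%:Z); last by rewrite gv mulrA.
    rewrite /gam mulr_suml; apply: eq_bigr => i _; rewrite mulr_suml; apply: eq_bigr => j _.
    by rewrite !ffunE !PoszM; ring.
  have -> : - (hbar / 2 * (2 * (g * (k * k)%N%:Z))%:~R) = hbar *~ (- (g * (k * k)%N%:Z)).
    rewrite -[RHS]mulrzr intrN intrM -[(2 : int)%:~R]/(2 : R[i]).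
    by move: ((g * _)%:~R) => x; field.
  by rewrite expCMz; apply: inQq_q_exprz.
rewrite fsbig1 ?mul0r; first exact: inQq0.
by move=> k kn; case: nk; exists k.
Qed.

Lemma ev_pinv (A : algType R[i]) N c (x : A) : (0 < N)%N -> c 0%N = 1 -> x ^+ N = 0 ->
  ev N c x * ev N (pinv c) x = 1 /\ ev N (pinv c) x * ev N c x = 1.
Proof.
move=> N0 c0 xN; rewrite !ev_mul //.
have e1 : conv c (pinv c) = @one_coef _ by apply/funext => n; apply: conv_pinv.
have -> : conv (pinv c) c = conv c (pinv c) by apply/funext => n; apply: convC.
by rewrite e1 ev_one.
Qed.

Lemma weyl_series_inv c v : v != ezero -> c 0%N = 1 ->
  Amul hbar (weyl_series hbar c v) (weyl_series hbar (pinv c) v) = Aone R /\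
  Amul hbar (weyl_series hbar (pinv c) v) (weyl_series hbar c v) = Aone R.
Proof.
move=> v0 c0.
have h K := @ev_pinv _ (12 * K).+1 _ _ isT c0
  (nil_expr (@box_filtration R K) (@weyl_filt R hbar K v v0)).
have E c' K := weyl_series_mx hbar K c' v0.
split; apply: (@box_mx_inj _ hbar) => K; have [h1 h2] := h K.
  by rewrite box_mxM (E c K) (E (pinv c) K) box_mx1 h1.
by rewrite box_mxM (E c K) (E (pinv c) K) box_mx1 h2.
Qed.

Lemma weyl_series_unit c v g : v != ezero -> gam v = 2 * g -> c 0%N = 1 ->
  (forall n, inQq hbar (c n)) ->
  Aunit hbar (weyl_series hbar c v) /\ Aunit hbar (weyl_series hbar (pinv c) v).
Proof.
move=> v0 gv c0 hc; have [h1 h2] := weyl_series_inv v0 c0.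
have hp n : inQq hbar (pinv c n) by apply: pinv_Qq.
have ic := inA_weyl_series gv hc; have ip := inA_weyl_series gv hp.
by split; (split; first by []); [exists (weyl_series hbar (pinv c) v) | exists (weyl_series hbar c v)].
Qed.

Definition ser (d : nat) (s : seq nat) : Aseries R :=
  weyl_series hbar (psi_coef (q ^+ d)) (expo_seq s).

Definition serV (d : nat) (s : seq nat) : Aseries R :=
  weyl_series hbar (pinv (psi_coef (q ^+ d))) (expo_seq s).

Definition ser_conj (s t : seq nat) : Aseries R :=
  Amul hbar (Amul hbar (ser 2 s) (ser 1 t)) (serV 2 s).

Lemma bform_expo_seq s t : bform (expo_seq s) (expo_seq t) = comega (clin s) (clin t).
Proof. by rewrite -(omega_Lin lam0) !Lin_coords omega_coords. Qed.

Section Matrices.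
Variable K : nat.
Let N := (12 * K).+1%N.
Let X s := box_mx hbar K (weyl hbar (expo_seq s)).

Lemma X_comm s t z : comega (clin s) (clin t) = z -> X s * X t = q ^ z *: (X t * X s).
Proof.
move=> st; rewrite /X !weyl_mxM !bform_expo_seq.
have -> : eadd (expo_seq t) (expo_seq s) = eadd (expo_seq s) (expo_seq t).
  by apply/ffunP => i; rewrite !ffunE addnC.
rewrite scalerA -expCMz -expCD; congr (expC _ *: _).
have -> : comega (clin t) (clin s) = - z.
  by rewrite -!(omega_coords lam0) omegaC omega_coords st.
rewrite st intrN -[hbar *~ z]mulrzr; move: (z%:~R) => x; by field.
Qed.

(** In Weyl order, the monomial of a sum is the product up to q to half the commutation exponent. *)
Lemma X_add s t u z : comega (clin s) (clin t) = 2 * z ->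
  all (fun i => nth 0 s i + nth 0 t i == nth 0 u i)%N (iota 0 12) ->
  X u = q ^ (- z) *: (X s * X t).
Proof.
move=> st /expo_seq_add su; rewrite /X weyl_mxM su.
rewrite bform_expo_seq st scalerA -expCMz -expCD.
rewrite -[hbar *~ _]mulrzr intrN intrM -[(2 : int)%:~R]/(2 : R[i]).
have -> : hbar * - z%:~R + hbar / 2 * (2 * z%:~R) = 0 by move: (z%:~R) => x; field.
by rewrite expC0 scale1r.
Qed.

Lemma ser_mx d s : has (fun i => nth 0%N s i != 0%N) (iota 0 12) ->
  box_mx hbar K (ser d s) = ev N (psi_coef (q ^+ d)) (X s).
Proof. by move=> /expo_seq_neq0 s0; rewrite weyl_series_mx. Qed.

End Matrices.
End SeriesUnits.

(* Vertices are numbered from 1, positions in the result from 0. *)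
Definition vertex_count (s : seq nat) : seq nat := mkseq (fun i => count_mem i.+1 s) 12.

(** * The dilogarithm identity for series in the Y_i *)

Section SeriesReflection.
Variables (R : realType) (hbar : R[i]).
Let q := expC hbar.
Hypothesis q_generic : forall n : nat, (0 < n)%N -> q ^+ n != 1.

Local Notation N K := (12 * K).+1%N.
Local Notation X K s := (box_mx hbar K (weyl hbar (expo_seq s))).

Lemma X_filt K s : has (fun i => nth 0%N s i != 0%N) (iota 0 12) -> box_filt 1 (X K s).
Proof. by move=> /expo_seq_neq0 s0; apply: weyl_filt. Qed.

Lemma ev_unit K d x : (0 < d)%N -> @box_filt R K 1 x ->
  ev (N K) (psi_coef (q ^+ d)) x \is a GRing.unit.
Proof.
move=> d0 hx; have xN := nil_expr (@box_filtration R K) hx; apply/unitrP.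
exists (ev (N K) (pinv (psi_coef (q ^+ d))) x).
have [h1 h2] := @ev_pinv R _ (N K) _ x isT (proj1 (psi_coef_rec q_generic d0)) xN.
exact: conj h2 h1.
Qed.

Lemma serV_mx K d s : (0 < d)%N -> has (fun i => nth 0%N s i != 0%N) (iota 0 12) ->
  box_mx hbar K (serV hbar d s) = (ev (N K) (psi_coef (q ^+ d)) (X K s))^-1.
Proof.
move=> d0 s0; have h := ev_unit d0 (@X_filt K s s0).
apply: (mulrI h); rewrite divrr // /serV (weyl_series_mx _ _ _ (expo_seq_neq0 s0)).
have [h1 _] := @ev_pinv R _ (N K) _ (X K s) isT (proj1 (psi_coef_rec q_generic d0))
  (nil_expr (@box_filtration R K) (@X_filt K s s0)).
exact: h1.
Qed.

Let psi K := ev (A := 'M[R[i]]_((box_dim K).+1)) (N K) (psi_coef (q ^+ 1)).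
Let psi2 K := ev (A := 'M[R[i]]_((box_dim K).+1)) (N K) (psi_coef (q ^+ 2)).

Lemma ser_mxE K s x : has (fun i => nth 0%N s i != 0%N) (iota 0 12) -> X K s = x ->
  box_mx hbar K (ser hbar 1 s) = @psi K x.
Proof. by move=> hs <-; apply: ser_mx. Qed.

Lemma ser_conj_mxE K s t x : has (fun i => nth 0%N s i != 0%N) (iota 0 12) ->
  has (fun i => nth 0%N t i != 0%N) (iota 0 12) -> X K t = x ->
  box_mx hbar K (ser_conj hbar s t) = @psi2 K (X K s) * @psi K x / @psi2 K (X K s).
Proof.
move=> hs ht <-; rewrite /ser_conj 2!box_mxM.
exact: congr2 (congr2 *%R (ser_mx hbar K 2 hs) (ser_mx hbar K 1 ht)) (@serV_mx K 2 s isT hs).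
Qed.

Lemma ser_reflection :
  foldl (Amul hbar) (Aone R)
    [:: ser hbar 1 (vertex_count [:: 11]);
        ser_conj hbar (vertex_count [:: 3]) (vertex_count [:: 7; 11]);
        ser_conj hbar (vertex_count [:: 2]) (vertex_count [:: 6]);
        ser hbar 1 (vertex_count [:: 2; 6; 7]);
        ser hbar 1 (vertex_count [:: 10; 11]);
        ser_conj hbar (vertex_count [:: 3]) (vertex_count [:: 7; 10; 11]);
        ser hbar 1 (vertex_count [:: 10])] =
  foldl (Amul hbar) (Aone R)
    [:: ser hbar 1 (vertex_count [:: 10]);
        ser_conj hbar (vertex_count [:: 2]) (vertex_count [:: 6; 10]);
        ser hbar 1 (vertex_count [:: 2; 6; 7; 10]);
        ser hbar 1 (vertex_count [:: 11]);
        ser_conj hbar (vertex_count [:: 3]) (vertex_count [:: 7; 11]);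
        ser_conj hbar (vertex_count [:: 2]) (vertex_count [:: 6]);
        ser hbar 1 (vertex_count [:: 2; 6; 7])].
Proof.
apply: (@box_mx_inj _ hbar) => K.
pose va := vertex_count [:: 2]%N.
pose vb := vertex_count [:: 3]%N.
pose vc := vertex_count [:: 6]%N.
pose vd := vertex_count [:: 7]%N.
pose ve := vertex_count [:: 10]%N.
pose vf := vertex_count [:: 11]%N.
pose vdf := vertex_count [:: 7; 11]%N.
pose vac := vertex_count [:: 2; 6]%N.
pose vacd := vertex_count [:: 2; 6; 7]%N.
pose vef := vertex_count [:: 10; 11]%N.
pose vde := vertex_count [:: 7; 10]%N.
pose vdef := vertex_count [:: 7; 10; 11]%N.
pose vce := vertex_count [:: 6; 10]%N.
pose vacde := vertex_count [:: 2; 6; 7; 10]%N.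
set N := (12 * K).+1%N.
have filt := @box_filtration R K.
have Xfilt s := @X_filt K s.
have mxs s x := @ser_mxE K s x.
have cj s t x := @ser_conj_mxE K s t x.
rewrite /foldl 2!Aone_mul 12!box_mxM.
have q0 : q != 0 by apply: expC_neq0.
have Xdf : X K vdf = q^-1 *: (X K vd * X K vf) by apply: (@X_add R hbar K vd vf vdf 1).
have Xef : X K vef = q^-1 *: (X K ve * X K vf) by apply: (@X_add R hbar K ve vf vef 1).
have Xce : X K vce = q^-1 *: (X K vc * X K ve) by apply: (@X_add R hbar K vc ve vce 1).
have Xde : X K vde = X K vd * X K ve by rewrite -[RHS]scale1r; apply: (@X_add R hbar K vd ve vde 0).
have Xdef : X K vdef = q ^- 2 *: (X K vd * X K ve * X K vf).
  by rewrite -Xde; apply: (@X_add R hbar K vde vf vdef 2).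
have Xac : X K vac = q ^- 2 *: (X K va * X K vc) by apply: (@X_add R hbar K va vc vac 2).
have Xacd : X K vacd = q^-1 *: (X K va * X K vc * X K vd).
  (* The commutation exponents 4 of a with c and -2 of a c with d give the factors q^-2 and q, hence
     the q^-1 in G. *)
  have -> : q^-1 *: (X K va * X K vc * X K vd) = q ^ 1 *: (X K vac * X K vd).
    by rewrite Xac -scalerAl scalerA; congr (_ *: _); field.
  by apply: (@X_add R hbar K vac vd vacd (- 1)).
have Xacde : X K vacde = q ^- 2 *: (X K va * X K vc * X K vd * X K ve).
  have -> : q ^- 2 *: (X K va * X K vc * X K vd * X K ve) = q ^- 1 *: (X K vacd * X K ve).
    by rewrite Xacd -scalerAl scalerA; congr (_ *: _); field.
  by apply: (@X_add R hbar K vacd ve vacde 1).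
have EL := congr2 *%R (congr2 *%R (congr2 *%R (congr2 *%R (congr2 *%R (congr2 *%R
  (mxs vf _ isT erefl) (cj vb vdf _ isT isT Xdf)) (cj va vc _ isT isT erefl))
  (mxs vacd _ isT Xacd)) (mxs vef _ isT Xef)) (cj vb vdef _ isT isT Xdef))
  (mxs ve _ isT erefl).
have ER := congr2 *%R (congr2 *%R (congr2 *%R (congr2 *%R (congr2 *%R (congr2 *%R
  (mxs ve _ isT erefl) (cj va vce _ isT isT Xce)) (mxs vacde _ isT Xacde))
  (mxs vf _ isT erefl)) (cj vb vdf _ isT isT Xdf)) (cj va vc _ isT isT erefl))
  (mxs vacd _ isT Xacd).
apply: etrans EL _; apply: etrans _ (esym ER).
have com0 s t : comega (clin s) (clin t) = 0 -> X K s * X K t = X K t * X K s.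
  by move=> /(@X_comm R hbar K); rewrite expr0z scale1r.
apply: (@dilogarithm_reflection _ _ N (@box_filt R K) filt q (psi_coef (q ^+ 1))
  (psi_coef (q ^+ 2)) q0 (psi_coef_rec q_generic (isT : 0 < 1)%N)
  (psi_coef_rec q_generic (isT : 0 < 2)%N) (q_generic2 q_generic (isT : 0 < 1)%N)
  (fun x => @ev_unit K 1%N x isT) (fun x => @ev_unit K 2%N x isT)
  (X K va) (X K vb) (X K vc) (X K vd) (X K ve) (X K vf)); try exact: Xfilt; try exact: erefl;
  try (by apply: com0; vm_compute).
- by apply: (@X_comm R hbar K vb va (- 4)).
- by apply: (@X_comm R hbar K vc va (- 4)).
- by apply: (@X_comm R hbar K vd va 4).
- by apply: (@X_comm R hbar K vd vb (- 4)).
- by apply: (@X_comm R hbar K vd vc (- 2)).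
- by apply: (@X_comm R hbar K ve vc (- 2)).
- by apply: (@X_comm R hbar K vf vc 2).
- by apply: (@X_comm R hbar K vf vd (- 2)).
by apply: (@X_comm R hbar K vf ve (- 2)).
Qed.

End SeriesReflection.

(** * The reflection equation *)

(* An operator P_ijk or P^K_ijkl, respectively R_ijk or K_ijkl, is represented by
   the list of its indices. *)
Definition op_ok (s : seq nat) : bool :=
  match s with
  | [:: i; j; k] => [&& vtx i != vtx j, vtx i != vtx k & wt (vtx j) == wt (vtx k)]
  | [:: i; j; k; l] => [&& vtx i != vtx j, vtx i != vtx l & wt (vtx j) == wt (vtx l)]
  | _ => false
  end.

Definition op_coords (s : seq nat) (D : coords) : coords :=
  match s with
  | [:: i; j; k] => cP (vtx i) (vtx j) (vtx k) D
  | [:: i; j; k; l] => cPK (vtx i) (vtx j) (vtx k) (vtx l) D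
  | _ => D
  end.

Definition op_swap (s : seq nat) (t : nat) : nat :=
  match s with
  | [:: i; j; k] => cswap (vtx j) (vtx k) t
  | [:: i; j; k; l] => cswap (vtx j) (vtx l) t
  | _ => t
  end.

Definition short_arg (i j k : nat) : coords :=
  csum [:: (1, vtx_p i); (1, vtx_u i); (1, vtx_p k); (- 1, vtx_u k); (- 1, vtx_p j);
           (1, vtx_l i); (- 1, vtx_l k)].

Definition long_arg (j k l : nat) : coords :=
  csum [:: (1, vtx_p j); (1, vtx_u j); (1, vtx_p l); (- 1, vtx_u l); (- 2, vtx_p k);
           (1, vtx_l j); (- 1, vtx_l l)].

(** A nonzero exponent makes the monomial nilpotent in every box; the evenness of [cgam] is what
    [inA_weyl_series] asks for. *)
Definition expo_ok (v : seq nat) : bool :=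
  has (fun i => nth 0%N v i != 0%N) (iota 0 12) && (2 * (cgam v %/ 2)%Z == cgam v).

(* The factor with indices s, moved past the operators with indices in L, is the
   series with exponents vs. *)
Definition factor_ok (L : seq (seq nat)) (s : seq nat) (vs : seq (seq nat)) : bool :=
  match s, vs with
  | [:: i; j; k], [:: v] =>
      expo_ok v && (foldr op_coords (short_arg i j k) L == clin v)
  | [:: i; j; k; l], [:: v; w] =>
      [&& expo_ok v, expo_ok w, foldr op_coords (long_arg j k l) L == clin v &
          foldr op_coords (short_arg i j k) L == clin w]
  | _, _ => false
  end.

(** [L] collects the operators to the left of the current factor. *)
Fixpoint factors_ok (L s : seq (seq nat)) (vs : seq (seq (seq nat))) : bool :=
  match s, vs with
  | x :: s', v :: vs' => [&& op_ok x, factor_ok L x v & factors_ok (rcons L x) s' vs']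
  | [::], [::] => true
  | _, _ => false
  end.

(** * Moving the operators past the series *)

Section Assembly.
Variables (R : realType) (hbar : R[i]) (lam : 'I_9 -> R[i]).
Let q := expC hbar.
Hypothesis q_generic : forall n : nat, (0 < n)%N -> q ^+ n != 1.

Definition op_NS (s : seq nat) : NSelt R :=
  match s with
  | [:: i; j; k] => Pop lam (vtx i) (vtx j) (vtx k)
  | [:: i; j; k; l] => PKop lam (vtx i) (vtx j) (vtx k) (vtx l)
  | _ => NSone R
  end.

Definition op_sd (s : seq nat) : sdelt R :=
  match s with
  | [:: i; j; k] => Rop hbar lam (vtx i) (vtx j) (vtx k)
  | [:: i; j; k; l] => Kop hbar lam (vtx i) (vtx j) (vtx k) (vtx l)
  | _ => sdone R
  end.

Lemma op_inNS s : op_ok s -> inNS (op_NS s).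
Proof.
by case: s => [|i[|j[|k[|l[|? ?]]]]] //= /and3P[h1 h2 /eqP h3];
   [apply: inNS_P | apply: inNS_PK].
Qed.

Lemma op_symplectic s : op_ok s -> symplectic (Ad (op_NS s)).
Proof.
by case: s => [|i[|j[|k[|l[|? ?]]]]] //= /and3P[h1 h2 /eqP h3];
   [apply: P_symplectic | apply: PK_symplectic].
Qed.

Lemma op_Ad s D : Ad (op_NS s) (of_coords lam D) = of_coords lam (op_coords s D).
Proof.
by case: s => [|i[|j[|k[|l[|? ?]]]]]; rewrite ?Ad_one //; [apply: Ad_P_coords | apply: Ad_PK_coords].
Qed.

Lemma NSprod_rcons (s : seq (NSelt R)) x : NSprod (rcons s x) = NSmul (NSprod s) x.
Proof. by rewrite /NSprod foldl_rcons. Qed.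

Lemma NSprod_symplectic L : all op_ok L -> symplectic (Ad (NSprod (map op_NS L))).
Proof.
elim/last_ind: L => [_|L s IH]; first by rewrite [NSprod _]/(NSone R) Ad_one; apply: symplectic_id.
rewrite all_rcons map_rcons NSprod_rcons Ad_mul => /andP[hs hL].
by apply: symplectic_comp; [apply: IH | apply: op_symplectic].
Qed.

(** The rightmost operator acts first, whence [foldr]. *)
Lemma NSprod_Ad L D :
  Ad (NSprod (map op_NS L)) (of_coords lam D) = of_coords lam (foldr op_coords D L).
Proof.
elim/last_ind: L D => [|L s IH] D; first by rewrite [NSprod _]/(NSone R) Ad_one.
by rewrite map_rcons NSprod_rcons Ad_mul /comp op_Ad IH foldr_rcons.
Qed.

Lemma NSprod_scalar L : (NSprod (map op_NS L)).1.1 = 1.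
Proof.
elim/last_ind: L => [//|L s IH]; rewrite map_rcons NSprod_rcons.
rewrite -[LHS]/((NSprod (map op_NS L)).1.1 * (op_NS s).1.1) IH mul1r.
by case: s => [|i[|j[|k[|l[|? ?]]]]] //=; rewrite !mulr1.
Qed.

Lemma NSprod_perm L (t : 'I_9) :
  (NSprod (map op_NS L)).2 t = foldr op_swap t L :> nat.
Proof.
have op s (x : 'I_9) : (op_NS s).2 x = op_swap s x :> nat.
  by case: s => [|i[|j[|k[|l[|? ?]]]]]; rewrite /= ?mul1g ?perm1 // cswapE.
elim/last_ind: L t => [|L s IH] t; first by rewrite perm1.
rewrite map_rcons NSprod_rcons foldr_rcons.
by rewrite -[LHS]/(nat_of_ord (((op_NS s).2 * (NSprod (map op_NS L)).2)%g t)) permM IH op.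
Qed.

Lemma NSprod_eq L L' : all op_ok L -> all op_ok L' ->
  all (fun i => [&& foldr op_coords (cp i) L == foldr op_coords (cp i) L',
    foldr op_coords (cu i) L == foldr op_coords (cu i) L' &
    foldr op_swap i L == foldr op_swap i L']) (iota 0 9) ->
  NSprod (map op_NS L) = NSprod (map op_NS L').
Proof.
move=> hL hL' /allP h.
have hi (i : 'I_9) := h i (eq_ind_r is_true (ltn_ord i) (mem_iota 0 9 i)).
apply: NSelt_eq.
- by rewrite !NSprod_scalar.
- apply: symplectic_ext; try exact: NSprod_symplectic; move=> i; have /and3P[h1 h2 h3] := hi i.
    by rewrite -(of_coords_p lam) 2!NSprod_Ad (eqP h1).
  by rewrite -(of_coords_u lam) 2!NSprod_Ad (eqP h2).
apply/permP => i; have /and3P[_ _ /eqP h3] := hi i.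
by apply: val_inj; rewrite /= 2!NSprod_perm.
Qed.

Lemma lcstB (x y : R[i]) : Defs.cst (x - y) = Defs.cst x - Defs.cst y.
Proof.
apply: (canRL (addrK _)); rewrite -lcstD.
by rewrite subrK.
Qed.

Lemma of_coords_csum s :
  of_coords lam (csum s) = foldr (fun x L => of_coords lam x.2 *~ x.1 + L) 0 s.
Proof.
elim: s => [|x s IH]; first exact: of_coords0.
by rewrite /= of_coordsD of_coordsZ IH.
Qed.

Lemma short_argE i j k : of_coords lam (short_arg i j k) =
  pf R (vtx i) + uf R (vtx i) + pf R (vtx k) - uf R (vtx k) - pf R (vtx j) +
  Defs.cst (lam (vtx i) - lam (vtx k)).
Proof.
rewrite of_coords_csum /foldr /fst /snd /vtx_p /vtx_u /vtx_l.
rewrite !of_coords_p !of_coords_u !of_coords_l lcstB.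
move: (pf _ _) (uf _ _) (pf _ _) (uf _ _) (pf _ _) (Defs.cst _) (Defs.cst _) => a b c d e x y.
by rewrite !mulr1z !mulrN1z addr0 !addrA.
Qed.

Lemma long_argE j k l : of_coords lam (long_arg j k l) =
  pf R (vtx j) + uf R (vtx j) + pf R (vtx l) - uf R (vtx l) - pf R (vtx k) *+ 2 +
  Defs.cst (lam (vtx j) - lam (vtx l)).
Proof.
rewrite of_coords_csum /foldr /fst /snd /vtx_p /vtx_u /vtx_l.
rewrite !of_coords_p !of_coords_u !of_coords_l lcstB.
move: (pf _ _) (uf _ _) (pf _ _) (uf _ _) (pf _ _) (Defs.cst _) (Defs.cst _) => a b c d e x y.
by rewrite !mulr1z !mulrN1z addr0 mulrNz !addrA.
Qed.

Definition factor (vs : seq (seq nat)) : Aseries R :=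
  match vs with
  | [:: v] => ser hbar 1 v
  | [:: v; w] => ser_conj hbar v w
  | _ => Aone R
  end.

Lemma ser_unit d v : (0 < d)%N -> expo_ok v ->
  Aunit hbar (ser hbar d v) /\ Aunit hbar (serV hbar d v).
Proof.
move=> d0 /andP[/expo_seq_neq0 v0 /eqP gv].
have [c0 _] := psi_coef_rec q_generic d0.
by apply: (weyl_series_unit v0 (etrans (gam_expo_seq v) (esym gv)) c0) => n; apply: psi_coef_Qq.
Qed.

(** The operators change only the exponent of the dilogarithm. Being a nonnegative combination of
    the [phiY i], the new exponent places the series in the image of [phi_hat]. *)
Lemma AdF_series L c D v : all op_ok L -> foldr op_coords D L = clin v ->
  AdF (NSprod (map op_NS L)) (subst_exp c (of_coords lam D)) =
  phi_hat hbar lam (weyl_series hbar c (expo_seq v)).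
Proof.
move=> /NSprod_symplectic hL Dv; rewrite (AdF_subst hL) NSprod_Ad Dv -Lin_coords.
by rewrite phi_hat_weyl_series.
Qed.

Lemma factor_okP L s vs : all op_ok L -> factor_ok L s vs ->
  AdF (NSprod (map op_NS L)) (op_sd s).1 = phi_hat hbar lam (factor vs) /\
  Aunit hbar (factor vs).
Proof.
move=> hL; case: s => [|i[|j[|k[|l[|? ?]]]]] //; case: vs => [|v[|w[|? ?]]] //.
  move=> /andP[hv /eqP e]; split; last by have [] := @ser_unit 1 v isT hv.
  by rewrite -[(op_sd _).1]/(subst_exp _ _) -short_argE; apply: AdF_series.
move=> /and4P[hv hw /eqP ev /eqP ew]; split; last first.
  have [hv1 hv2] := @ser_unit 2 v isT hv; have [hw1 _] := @ser_unit 1 w isT hw.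
  by apply: Aunit_mul => //; apply: Aunit_mul.
rewrite /factor /ser_conj !phi_hatM /ser /serV.
rewrite -(AdF_series _ hL ev) -(AdF_series _ hL ew) -(AdF_series _ hL ev).
rewrite -!(AdF_mul hbar (NSprod_symplectic hL)).
by rewrite long_argE short_argE.
Qed.

Lemma phi_hat_one : phi_hat hbar lam (Aone R) = Fone R.
Proof.
have Lin0 : Lin lam ezero = 0 by apply: big1 => i _; rewrite ffunE.
apply/funext => m; have [[n <-]|nm] := pselect (exists n, (Lin lam n).1 = m).
  rewrite phi_hat_in -(weyl0 hbar) /weyl /Fone; have [->|n0] := eqVneq n ezero.
    by rewrite gam0 phi_mon2 gam0 Lin0 eqxx !mulr0 oppr0 addr0 expC0 mulr1.
  rewrite mul0r; case: eqP => // h; case/eqP: n0; apply: (@Lin_inj R lam).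
  by rewrite h Lin0.
rewrite phi_hat_out; last by move=> n e; apply: nm; exists n.
rewrite /Fone; case: eqP => // m0; case: nm; exists ezero.
by rewrite Lin0 m0.
Qed.

(** The accumulator holds a unit in the image of [phi_hat] and the product of the operators in [L];
    the next factor is seen through the adjoint action of that product. *)
Lemma sdprod_factors L s vs acc a : all op_ok L -> factors_ok L s vs ->
  acc.1 = phi_hat hbar lam a -> acc.2 = NSprod (map op_NS L) -> Aunit hbar a ->
  [/\ (foldl (sdmul hbar) acc (map op_sd s)).1 =
        phi_hat hbar lam (foldl (Amul hbar) a (map factor vs)),
      Aunit hbar (foldl (Amul hbar) a (map factor vs)),
      (foldl (sdmul hbar) acc (map op_sd s)).2 = NSprod (map op_NS (L ++ s)) &
      forall k, (k < size s)%N -> inWAx hbar lam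
        (AdF (NSprod (map op_NS (L ++ take k s))) (nth (sdone R) (map op_sd s) k).1)].
Proof.
elim: s vs L acc a => [|x s IH] [|v vs] // L acc a hL.
  by move=> _ ha h2 ua; split=> //=; rewrite cats0.
move=> /= /and3P[hx hv hs] ha h2 ua.
have [hf uf] := factor_okP hL hv.
have op2 : (op_sd x).2 = op_NS x by case: (x) => [|i[|j[|k[|l[|? ?]]]]].
have hLx : all op_ok (rcons L x) by rewrite all_rcons hx.
have [] := IH vs (rcons L x) (sdmul hbar acc (op_sd x)) (Amul hbar a (factor v)) hLx hs.
- by rewrite /sdmul phi_hatM -hf ha h2.
- by rewrite map_rcons NSprod_rcons -h2 -op2.
- exact: Aunit_mul.
move=> h1 h3 h4 h5; split=> //; first by rewrite h4 cat_rcons.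
case=> [_|k hk]; first by rewrite /= cats0; exists (factor v).
by have := h5 k hk; rewrite cat_rcons.
Qed.

Lemma unzip2_op_sd s : unzip2 (map op_sd s) = map op_NS s.
Proof.
rewrite /unzip2 -map_comp; apply: eq_map => x /=.
by case: x => [|i[|j[|k[|l[|? ?]]]]].
Qed.

Lemma sdprod_product s vs : factors_ok [::] s vs ->
  [/\ product_in_WAx hbar lam (map op_sd s),
      (sdprod hbar (map op_sd s)).1 = phi_hat hbar lam (foldl (Amul hbar) (Aone R) (map factor vs)) &
      (sdprod hbar (map op_sd s)).2 = NSprod (map op_NS s)].
Proof.
move=> hs; have [h1 h2 h3 h4] := @sdprod_factors [::] s vs (sdone R) (Aone R) isT hs
  (esym phi_hat_one) erefl (Aunit_one hbar).
split=> //; split; last by exists (foldl (Amul hbar) (Aone R) (map factor vs)).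
by move=> k; rewrite size_map -map_take unzip2_op_sd => /h4.
Qed.

End Assembly.

(** * The two sides of the reflection equation *)

Definition ops : seq (seq nat) :=
  [:: [:: 4; 5; 7]; [:: 4; 6; 8; 9]; [:: 2; 3; 7; 9]; [:: 2; 5; 8]; [:: 1; 7; 8];
      [:: 1; 3; 5; 6]; [:: 1; 2; 4]]%N.

(** The quiver vertices making up each transported exponent: one list for R, a long one followed by
    a short one for K. Only the inner vertices 2, 3, 6, 7, 10, 11 occur. *)
Definition lhs_expos : seq (seq (seq nat)) := map (map vertex_count)
  [:: [:: [:: 11]]; [:: [:: 3]; [:: 7; 11]]; [:: [:: 2]; [:: 6]]; [:: [:: 2; 6; 7]];
      [:: [:: 10; 11]]; [:: [:: 3]; [:: 7; 10; 11]]; [:: [:: 10]]]%N.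

Definition rhs_expos : seq (seq (seq nat)) := map (map vertex_count)
  [:: [:: [:: 10]]; [:: [:: 2]; [:: 6; 10]]; [:: [:: 2; 6; 7; 10]]; [:: [:: 11]];
      [:: [:: 3]; [:: 7; 11]]; [:: [:: 2]; [:: 6]]; [:: [:: 2; 6; 7]]]%N.

Lemma ops_ok : all op_ok ops. Proof. by vm_compute. Qed.
Lemma rev_ops_ok : all op_ok (rev ops). Proof. by vm_compute. Qed.
Lemma lhs_factors : factors_ok [::] ops lhs_expos. Proof. by vm_compute. Qed.
Lemma rhs_factors : factors_ok [::] (rev ops) rhs_expos. Proof. by vm_compute. Qed.
(** Both products are evaluated on the p_i, the u_i and the indices, in integer coordinates that
    hold for all lambda at once. *)
Lemma NSprod_ops (R : realType) (lam : 'I_9 -> R[i]) :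
  NSprod (map (op_NS lam) ops) = NSprod (map (op_NS lam) (rev ops)).
Proof. by apply: NSprod_eq ops_ok rev_ops_ok _; vm_compute. Qed.

Lemma factor_ops (R : realType) (hbar : R[i])
  (q_generic : forall n : nat, (0 < n)%N -> expC hbar ^+ n != 1) :
  foldl (Amul hbar) (Aone R) (map (factor hbar) lhs_expos) =
  foldl (Amul hbar) (Aone R) (map (factor hbar) rhs_expos).
Proof. exact: (ser_reflection q_generic). Qed.

Lemma pair_eq (A B : Type) (x y : A * B) : x.1 = y.1 -> x.2 = y.2 -> x = y.
Proof. by case: x y => [? ?] [? ?] /= -> ->. Qed.

Lemma sdprod_ops (R : realType) (hbar : R[i]) (lam : 'I_9 -> R[i])
    (q_generic : forall n : nat, (0 < n)%N -> expC hbar ^+ n != 1) :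
  sdprod hbar (map (op_sd hbar lam) ops) = sdprod hbar (map (op_sd hbar lam) (rev ops)).
Proof.
have [_ e1 w1] := sdprod_product lam q_generic lhs_factors.
have [_ e2 w2] := sdprod_product lam q_generic rhs_factors.
have e := etrans e1 (etrans (congr1 (phi_hat hbar lam) (factor_ops q_generic)) (esym e2)).
have w := etrans w1 (etrans (NSprod_ops lam) (esym w2)).
exact: pair_eq e w.
Qed.

Theorem theorem5p4 (R : realType) (hbar : R[i]) (lam : 'I_9 -> R[i])
    (q_generic : forall n : nat, (0 < n)%N -> expC hbar ^+ n != 1) :
  let P i j k := Pop lam (vtx i) (vtx j) (vtx k) in
  let PK i j k l := PKop lam (vtx i) (vtx j) (vtx k) (vtx l) in
  let RR i j k := Rop hbar lam (vtx i) (vtx j) (vtx k) in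
  let KK i j k l := Kop hbar lam (vtx i) (vtx j) (vtx k) (vtx l) in
  let Plhs := [:: P 4 5 7; PK 4 6 8 9; PK 2 3 7 9; P 2 5 8; P 1 7 8;
                  PK 1 3 5 6; P 1 2 4]%N in
  let Prhs := [:: P 1 2 4; PK 1 3 5 6; P 1 7 8; P 2 5 8; PK 2 3 7 9;
                  PK 4 6 8 9; P 4 5 7]%N in
  let lhs := [:: RR 4 5 7; KK 4 6 8 9; KK 2 3 7 9; RR 2 5 8; RR 1 7 8;
                 KK 1 3 5 6; RR 1 2 4]%N in
  let rhs := [:: RR 1 2 4; KK 1 3 5 6; RR 1 7 8; RR 2 5 8; KK 2 3 7 9;
                 KK 4 6 8 9; RR 4 5 7]%N in
  ((forall n, (n < 7)%N -> inNS (nth (NSone R) Plhs n)) /\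
   NSprod Plhs = NSprod Prhs) /\
  [/\ product_in_WAx hbar lam lhs,
      product_in_WAx hbar lam rhs &
      sdprod hbar lhs = sdprod hbar rhs].
Proof.
move=> P PK RR KK Plhs Prhs lhs rhs.
have -> : Plhs = map (op_NS lam) ops by [].
have -> : Prhs = map (op_NS lam) (rev ops) by [].
have -> : lhs = map (op_sd hbar lam) ops by [].
have -> : rhs = map (op_sd hbar lam) (rev ops) by [].
have [p1 _ _] := sdprod_product lam q_generic lhs_factors.
have [p2 _ _] := sdprod_product lam q_generic rhs_factors.
split; last by split; [exact: p1 | exact: p2 | exact: sdprod_ops].
split; last exact: NSprod_ops.
move=> k k7; rewrite (nth_map [::]) //.
by apply: op_inNS; apply: (allP ops_ok); apply: mem_nth.
Qed.
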